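(* Let $k\ge3$ be odd and let $n,B\in\mathbb{N}$ with $n\ge kB$ and $k\le B$; let $f_j=1/j$ for $j\in[n]$. Let $h_1,\dots,h_k:[n]\to[B]$ and $s_1,\dots,s_k:[n]\to\{-1,1\}$ be independent, truly (uniformly) random hash functions. For $i\in[n]$ define $$\tilde f_i=\operatorname{median}_{\ell\in[k]}\Big(s_\ell(i)\sum_{j\in[n]}[h_\ell(j)=h_\ell(i)]\,s_\ell(j)\,f_j\Big).$$ Then for every $i\in[n]$, $$\mathbb{E}\big[|\tilde f_i-f_i|\big]=\Omega\!\left(\frac{1}{B\sqrt{k}\log k}\right)\quad\text{and}\quad \mathbb{E}\big[|\tilde f_i-f_i|\big]=O\!\left(\frac{1}{B\sqrt{k}}\right),$$ with absolute implied constants.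
   Context: $[E]$ denotes the indicator of the event $E$; the median of $k$ (odd) reals is the middle value after sorting. This is the Count-Sketch estimate with $k$ rows of $B$ buckets each for Zipfian frequencies $f_j=1/j$. *)

(* Defs.v *)
From mathcomp Require Import all_boot all_order all_algebra.
From mathcomp Require Import reals exp.

Set Implicit Arguments.
Unset Strict Implicit.
Unset Printing Implicit Defensive.
Import Order.TTheory GRing.Theory Num.Theory.
Local Open Scope ring_scope.

(* A k-tuple of hash functions [n] -> [B] together with a k-tuple of sign
   functions [n] -> {-1, 1}.  A sign is encoded by a bit b, standing for
   (-1) ^+ b.  Under the uniform distribution on this finite product type, the
   2k functions are mutually independent and each is uniformly random. *)
Definition sketch (k n B : nat) : finType :=
  ({ffun 'I_k -> {ffun 'I_n -> 'I_B}} * {ffun 'I_k -> {ffun 'I_n -> bool}})%type.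

Definition uniform_expectation (R : realType) (Omega : finType)
    (X : Omega -> R) : R :=
  (\sum_(w : Omega) X w) / #|Omega|%:R.

(* The middle value after sorting, for s of odd size. *)
Definition median (R : realType) (s : seq R) : R :=
  nth 0 (sort <=%R s) (size s)./2.

(* The item j of {1, ..., n} is represented by the ordinal of value j - 1. *)
Definition zipf (R : realType) (n : nat) (j : 'I_n) : R := (j.+1)%:R^-1.

Section CountSketch.
Variables (R : realType) (k n B : nat).

Definition hash (w : sketch k n B) (l : 'I_k) (j : 'I_n) : 'I_B := w.1 l j.

Definition sgn (w : sketch k n B) (l : 'I_k) (j : 'I_n) : R := (-1) ^+ w.2 l j.

Definition row_estimate (w : sketch k n B) (i : 'I_n) (l : 'I_k) : R :=
  sgn w l i *
  \sum_(j < n) (hash w l j == hash w l i)%:R * sgn w l j * zipf R j.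

Definition count_sketch (w : sketch k n B) (i : 'I_n) : R :=
  median [seq row_estimate w i l | l <- enum 'I_k].

Definition expected_error (i : 'I_n) : R :=
  uniform_expectation (fun w : sketch k n B => `|count_sketch w i - zipf R i|).

End CountSketch.

Arguments expected_error : clear implicits.
Arguments expected_error R k {n} B i.

(* Main.v *)
Require Import Defs.
From mathcomp Require Import all_boot all_order all_algebra.
From mathcomp Require Import reals exp.
From mathcomp Require Import ring lra zify.
From mathcomp Require Import trigo.

(** The error of a row is X = sum_(j <> i) Y_j eps_j / j with independent
    Bernoulli(1/B) variables Y_j and uniform signs eps_j, and the error of the
    sketch is the median of k independent copies of X.

    Upper bound: P(|X| <= t/B) >= t/180 for t <= 1, and P(|X| > t/B) <= 4/t.
    The median exceeds t/B only if a majority of the rows do, and a Chernoff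
    bound turns the two estimates into P(|median| > t/B) = O(1/(k t^2)) for all
    t > 0, which is integrated in steps of 1/sqrt k.

    Lower bound: the items j in [Bm, 2Bm] give E cos(B m X) <= rho^m with
    rho < 1, as long as 2m <= k; the squared Dirichlet kernel then yields
    P(|X| <= 1/(BN)) = O(1/N).  For N of order sqrt k only O(sqrt k) rows have
    an error below 1/(BN), while the numbers of larger positive and larger
    negative errors differ by order sqrt k with constant probability.  For
    bounded k, all rows err upwards by order 1/B with constant probability. *)

Set Implicit Arguments.
Unset Strict Implicit.
Unset Printing Implicit Defensive.
Import Order.TTheory GRing.Theory Num.Theory.
Local Open Scope ring_scope.

Local Notation mean := uniform_expectation.

(** * Expectations over finite uniform probability spaces *)

Section Mean.
Variables (R : realType) (Omega : finType).
Implicit Types X Y : Omega -> R.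

Lemma eq_mean X Y : X =1 Y -> mean X = mean Y.
Proof. by move=> eqXY; rewrite /mean (eq_bigr Y). Qed.

Lemma meanD X Y : mean (fun w => X w + Y w) = mean X + mean Y.
Proof. by rewrite /mean big_split mulrDl. Qed.

Lemma meanZ (a : R) X : mean (fun w => a * X w) = a * mean X.
Proof. by rewrite /mean -mulr_sumr mulrA. Qed.

Lemma meanB X Y : mean (fun w => X w - Y w) = mean X - mean Y.
Proof.
by rewrite meanD -[- mean Y]mulN1r -meanZ; congr (_ + _); apply: eq_mean => w; rewrite mulN1r.
Qed.

Lemma mean_sum (I : Type) (s : seq I) (X : I -> Omega -> R) :
  mean (fun w => \sum_(i <- s) X i w) = \sum_(i <- s) mean (X i).
Proof. by rewrite /mean exchange_big /= mulr_suml. Qed.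

Lemma le_mean X Y : (forall w, X w <= Y w) -> mean X <= mean Y.
Proof. by move=> leXY; rewrite ler_wpM2r ?invr_ge0 ?ler0n ?ler_sum. Qed.

Lemma mean_ge0 X : (forall w, 0 <= X w) -> 0 <= mean X.
Proof. by move=> X_ge0; rewrite mulr_ge0 ?invr_ge0 ?ler0n ?sumr_ge0. Qed.

Lemma mean_cst (a : R) : (0 < #|Omega|)%N -> mean (fun _ : Omega => a) = a.
Proof.
move=> O_gt0; rewrite /mean sumr_const -[a *+ _]mulr_natr mulfK //.
by rewrite pnatr_eq0 -lt0n.
Qed.

Lemma exchange_mean (Omega' : finType) (X : Omega -> Omega' -> R) :
  mean (fun w => mean (X w)) = mean (fun w' => mean (X^~ w')).
Proof.
rewrite /mean -!mulr_suml exchange_big /=.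
by rewrite -!mulrA [_^-1 * _]mulrC.
Qed.

Lemma mean_bij (Omega' : finType) (f : Omega' -> Omega) X :
  bijective f -> mean (X \o f) = mean X.
Proof.
move=> bij_f; rewrite /mean (bij_eq_card bij_f); congr (_ / _).
by rewrite [RHS](reindex f) //=; apply: onW_bij.
Qed.

Lemma mean_prod (Omega' : finType) (X : Omega * Omega' -> R) :
  mean X = mean (fun w => mean (fun w' => X (w, w'))).
Proof.
rewrite /mean -mulr_suml card_prod natrM invfM mulrA.
by rewrite pair_bigA [RHS]mulrAC /=; congr (_ / _ / _); apply: eq_bigr; case.
Qed.

End Mean.

(** * Independent coordinates *)

Section ProductMean.
Variables (R : realType) (I Omega : finType).
Implicit Types w : {ffun I -> Omega}.

Definition ffun_set w j o : {ffun I -> Omega} :=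
  [ffun i => if i == j then o else w i].

(* The map (w, o) |-> (w[j := o], w j) is an involution. *)
Lemma mean_resample (j : I) (X : {ffun I -> Omega} -> R) :
  (0 < #|Omega|)%N ->
  mean (fun o => mean (fun w => X (ffun_set w j o))) = mean X.
Proof.
move=> O_gt0; rewrite exchange_mean.
pose f (p : {ffun I -> Omega} * Omega) := (ffun_set p.1 j p.2, p.1 j).
have fK : involutive f.
  case=> w o; rewrite /f /ffun_set /= ffunE eqxx; congr (_, _).
  by apply/ffunP => i; rewrite !ffunE; case: eqP => // ->.
transitivity (mean ((fun p : {ffun I -> Omega} * Omega => X p.1) \o f)).
  by rewrite mean_prod.
rewrite (mean_bij _ (inv_bij fK)) mean_prod.
by apply: eq_mean => w /=; rewrite mean_cst.
Qed.

Lemma mean_coord (j : I) (X : Omega -> R) :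
  (0 < #|Omega|)%N -> mean (fun w => X (w j)) = mean X.
Proof.
move=> O_gt0.
rewrite -(mean_resample j) //; apply: eq_mean => o.
rewrite -[RHS](@mean_cst R {ffun I -> Omega}); last first.
  by rewrite card_ffun expn_gt0 O_gt0.
by apply: eq_mean => w; rewrite ffunE eqxx.
Qed.

Lemma mean_prod_coord (X : I -> Omega -> R) :
  mean (fun w => \prod_i X i (w i)) = \prod_i mean (X i).
Proof.
rewrite /mean big_split /= bigA_distr_bigA /=. congr (_ * _).
by rewrite prodr_const exprVn card_ffun natrX.
Qed.

Fixpoint iter_mean (V : nmodType) (g : I -> Omega -> V) (s : seq I)
    (F : V -> R) (x : V) : R :=
  if s is j :: s' then mean (fun o => iter_mean g s' F (x + g j o)) else F x.

(** Fubini, one coordinate at a time: resampling coordinate [j] replaces its value by an independent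
    [o], and [uniq s] ensures that the other summands do not see the replacement. *)
Lemma mean_sum_coord (V : nmodType) (g : I -> Omega -> V) (s : seq I)
    (F : V -> R) (x : V) : (0 < #|Omega|)%N -> uniq s ->
  mean (fun w => F (x + \sum_(j <- s) g j (w j))) = iter_mean g s F x.
Proof.
move=> O_gt0; elim: s x => [|j s IH] x /=.
  move=> _; rewrite -[RHS](@mean_cst R {ffun I -> Omega}); last first.
    by rewrite card_ffun expn_gt0 O_gt0.
  by apply: eq_mean => w; rewrite big_nil addr0.
case/andP=> js us; rewrite -(mean_resample j) //; apply: eq_mean => o.
rewrite -IH //; apply: eq_mean => w.
rewrite big_cons ffunE eqxx addrA; congr (F (_ + _)).
apply: eq_big_seq => i i_s; rewrite ffunE; case: eqP => // eij.
by rewrite -eij i_s in js.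
Qed.

End ProductMean.

(** * Lazy symmetric and Bernoulli walks *)

Section Walk.
Variable R : realType.
Implicit Types (q r x y u a t : R) (s : seq R) (F G : R -> R).

(* [walk q s F x] is the mean of [F (x + sum_(a <- s) Y_a * eps_a * a)] for
   independent Bernoulli(q) variables Y_a and uniform signs eps_a. *)
Fixpoint walk q s F x : R :=
  if s is a :: s' then
    (1 - q) * walk q s' F x + q / 2 * (walk q s' F (x + a) + walk q s' F (x - a))
  else F x.

(* [bern r s F x] is the mean of [F (x + sum_(a <- s) Y_a * a)]. *)
Fixpoint bern r s F x : R :=
  if s is a :: s' then (1 - r) * bern r s' F x + r * bern r s' F (x + a) else F x.

Lemma le_walk q s F G x : 0 <= q <= 1 -> (forall y, F y <= G y) ->
  walk q s F x <= walk q s G x.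
Proof.
move=> /andP[q0 q1] leFG; elim: s x => //= a s IH x.
by rewrite lerD ?ler_wpM2l ?lerD ?divr_ge0 ?subr_ge0.
Qed.

Lemma walk_cst q s a x : walk q s (fun=> a) x = a.
Proof. by elim: s x => //= b s IH x; rewrite !IH; field. Qed.

Lemma walk_opp q s F x : walk q s F (- x) = walk q s (fun y => F (- y)) x.
Proof.
elim: s x => //= a s IH x; rewrite -!IH opprD opprB [a - x]addrC.
by rewrite [walk _ _ _ (- x + a) + _]addrC.
Qed.

(** The sine terms of the addition formulas cancel between the steps [+a] and [-a], so each lazy
    step multiplies the mean by its characteristic function. *)
Lemma walk_cos q s u x :
  walk q s (fun y => cos (u * y)) x =
  cos (u * x) * \prod_(a <- s) (1 - q * (1 - cos (u * a))).
Proof.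
elim: s x => [|a s IH] x /=; first by rewrite big_nil mulr1.
by rewrite !IH big_cons !(mulrDr, mulrN) cosB cosD; field.
Qed.

(** A truncated Chebyshev inequality: an item with [a ^+ 2 >= t ^+ 2] is charged the probability [q]
    that it occurs at all, a smaller one its share of the variance. The few large items would
    otherwise dominate the variance. *)
Lemma walk_tail q s t x : 0 <= q <= 1 -> 0 < t ->
  walk q s (fun y => (t < `|y|)%R%:R) x <=
  x ^+ 2 / t ^+ 2 + q * \sum_(a <- s) Num.min 1 (a ^+ 2 / t ^+ 2).
Proof.
move=> qP t0; elim: s x => [|a s IH] x.
  rewrite big_nil mulr0 addr0 /=; have [tx|_] := ltrP.
    rewrite ler_pdivlMr ?exprn_gt0 // mul1r -(real_normK (num_real x)).
    by rewrite ler_pXn2r ?nnegrE ?normr_ge0 ?ltW.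
  by rewrite divr_ge0 ?sqr_ge0.
rewrite big_cons /=; set S := \sum_(_ <- _) _ in IH *.
have S0 : 0 <= S.
  by rewrite sumr_ge0 // => b _; rewrite le_min ler01 divr_ge0 ?sqr_ge0.
have W1 y : walk q s (fun y => (t < `|y|)%R%:R) y <= 1.
  by rewrite -[leRHS](walk_cst q s 1 y) le_walk // => z; rewrite lern1 leq_b1.
have /andP[q0 q1] := qP; have x0 : 0 <= x ^+ 2 / t ^+ 2 by rewrite divr_ge0 ?sqr_ge0.
have IHx := IH x; have qS : 0 <= q * S by rewrite mulr_ge0.
have IHq : (1 - q) * walk q s (fun y => (t < `|y|)%R%:R) x <=
   (1 - q) * (x ^+ 2 / t ^+ 2 + q * S) by rewrite ler_wpM2l ?subr_ge0.
rewrite minEle; case: ifP => _.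
  have := W1 (x + a); have := W1 (x - a); nra.
have E : q / 2 * (((x + a) ^+ 2 / t ^+ 2 + q * S) + ((x - a) ^+ 2 / t ^+ 2 + q * S)) =
   q * (x ^+ 2 / t ^+ 2 + a ^+ 2 / t ^+ 2 + q * S) by field; rewrite gt_eqF.
apply: le_trans (lerD IHq (ler_wpM2l _ (lerD (IH _) (IH _)))) _.
  by rewrite divr_ge0.
by rewrite E; lra.
Qed.

(** Retains only the event that no item in [P] occurs, of probability [(1 - q) ^+ count P s]; the
    other outcomes contribute nonnegatively. *)
Lemma walk_drop (P : pred R) q s F x : 0 <= q <= 1 -> (forall y, 0 <= F y) ->
  (1 - q) ^+ count P s * walk q (filter (predC P) s) F x <= walk q s F x.
Proof.
move=> qP F0; have /andP[q0 q1] := qP.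
have W0 s' y : 0 <= walk q s' F y.
  by rewrite -[leLHS](walk_cst q s' 0 y) le_walk.
have q1' : 0 <= 1 - q by rewrite subr_ge0.
elim: s x => [|a s IH] x /=; first by rewrite mul1r.
case: (P a) => /=.
  rewrite add1n exprS -mulrA -[leLHS]addr0 lerD ?ler_wpM2l //.
  by rewrite mulr_ge0 ?divr_ge0 ?addr_ge0.
rewrite add0n mulrDr mulrCA lerD ?ler_wpM2l //.
by rewrite mulrCA ler_wpM2l ?divr_ge0 // mulrDr lerD.
Qed.

Lemma eq_bern r s F G x : F =1 G -> bern r s F x = bern r s G x.
Proof. by move=> eqFG; elim: s x => //= a s IH x; rewrite !IH. Qed.

Lemma le_bern r s F G x : 0 <= r <= 1 -> (forall y, F y <= G y) ->
  bern r s F x <= bern r s G x.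
Proof.
move=> /andP[r0 r1] leFG; elim: s x => //= a s IH x.
by rewrite lerD ?ler_wpM2l ?subr_ge0.
Qed.

Lemma bern_cst r s a x : bern r s (fun=> a) x = a.
Proof. by elim: s x => //= b s IH x; rewrite !IH; ring. Qed.

Lemma bernD r s F G x :
  bern r s (fun y => F y + G y) x = bern r s F x + bern r s G x.
Proof. by elim: s x => //= a s IH x; rewrite !IH; ring. Qed.

Lemma bernZ r s a F x : bern r s (fun y => a * F y) x = a * bern r s F x.
Proof. by elim: s x => //= b s IH x; rewrite !IH; ring. Qed.

Lemma bern_sum r s (I : Type) (l : seq I) (F : I -> R -> R) x :
  bern r s (fun y => \sum_(i <- l) F i y) x = \sum_(i <- l) bern r s (F i) x.
Proof.
elim: l => [|i l IH].
  by rewrite big_nil -[RHS](bern_cst r s 0 x); apply: eq_bern => y; rewrite big_nil.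
by rewrite big_cons -IH -bernD; apply: eq_bern => y; rewrite big_cons.
Qed.

Lemma bern_sqr r s c x :
  bern r s (fun y => (y - c) ^+ 2) x =
  (x + r * (\sum_(a <- s) a) - c) ^+ 2 + r * (1 - r) * \sum_(a <- s) a ^+ 2.
Proof.
elim: s x => [|a s IH] x /=; first by rewrite !big_nil; ring.
by rewrite !IH !big_cons; ring.
Qed.

(* The lazy step Y * eps is the difference of two independent Bernoulli(r)
   variables. *)
Lemma walk_bern q r s F x y : 2 * r * (1 - r) = q ->
  walk q s F (x - y) = bern r s (fun u => bern r s (fun v => F (u - v)) y) x.
Proof.
move=> <-; elim: s x y => //= a s IH x y.
rewrite !bernD !bernZ -!IH.
have -> : x - y + a = x + a - y by ring.
have -> : x - y - a = x - (y + a) by ring.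
have -> : x + a - (y + a) = x - y by ring.
by field.
Qed.

Lemma sum_eq_ord_le (K : nat) (z : int) :
  \sum_(c < K) (z == c%:Z)%:R <= 1 :> R.
Proof.
case: (pickP (fun c : 'I_K => z == c%:Z)) => [c /eqP -> | no].
  rewrite (bigD1 c) //= eqxx big1 ?addr0 // => d /negPf dc.
  by rewrite eqz_nat eq_sym -val_eqE in dc *; rewrite dc.
by rewrite big1 ?ler01 // => c _; rewrite no.
Qed.

(* Writing the walk as V - V', the cells of an interval of length K * t around
   the mean of V carry half of its mass; V and V' share a cell with probability
   at least the sum of the squares of the masses. *)
Lemma walk_concentration q s (K : nat) t : 0 <= q <= 2^-1 -> 0 < t -> (0 < K)%N ->
  q * \sum_(a <- s) a ^+ 2 <= (K%:R * t / 2) ^+ 2 ->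
  (4 * K%:R)^-1 <= walk q s (fun y => (`|y| <= t)%R%:R) 0.
Proof.
move=> /andP[q0 q1] t0 K0 var_le.
(* The smaller root of [2 * r * (1 - r) = q], real because [q <= 1/2]. *)
pose r := (1 - Num.sqrt (1 - 2 * q)) / 2.
have sq : Num.sqrt (1 - 2 * q) ^+ 2 = 1 - 2 * q by rewrite sqr_sqrtr //; lra.
have rq : 2 * r * (1 - r) = q by rewrite /r; field: sq.
have s0 := sqrtr_ge0 (1 - 2 * q).
have s1 : Num.sqrt (1 - 2 * q) <= 1 by rewrite -(@expr_le1 _ 2) // sq; lra.
have rP : 0 <= r <= 1 by rewrite /r; apply/andP; split; lra.
rewrite -(subr0 0) (walk_bern _ _ _ _ rq).
pose w := K%:R * t / 2; pose mu := r * \sum_(a <- s) a.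
have K0' : 0 < K%:R :> R by rewrite ltr0n.
have w0 : 0 < w by rewrite /w; nra.
(* Number of the cell of length [t] containing [x], counted from [mu - w]. Since [2 * w = K * t],
   the cells [0] to [K - 1] cover [[mu - w, mu + w)]. *)
pose phi x : int := Num.floor ((x - (mu - w)) / t).
have phiP x : (phi x)%:~R * t <= x - (mu - w) < ((phi x)%:~R + 1) * t.
  rewrite -ler_pdivlMr // -ltr_pdivrMr //.
  by have := floor_itv ((x - (mu - w)) / t); rewrite intrD.
pose f (c : 'I_K) := bern r s (fun v => (phi v == c%:Z)%:R) 0.
have step1 : \sum_c f c ^+ 2 <=
   bern r s (fun u => bern r s (fun v => (`|u - v| <= t)%R%:R) 0) 0.
  have -> : \sum_c f c ^+ 2 = bern r s (fun u => bern r s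
     (fun v => \sum_(c < K) (phi u == c%:Z)%:R * (phi v == c%:Z)%:R) 0) 0.
    transitivity (bern r s (fun u => \sum_c f c * (phi u == c%:Z)%:R) 0).
      by rewrite bern_sum; apply: eq_bigr => c _; rewrite bernZ expr2.
    apply: eq_bern => u; rewrite bern_sum; apply: eq_bigr => c _.
    by rewrite bernZ mulrC.
  apply: le_bern => // u; apply: le_bern => // v.
  have [uv|uv] := lerP `|u - v| t.
    apply: le_trans (sum_eq_ord_le K (phi u)).
    by apply: ler_sum => c _; rewrite ler_piMr ?ler0n // lern1 leq_b1.
  rewrite big1 // => c _; case: eqP => [uc|]; last by rewrite mul0r.
  case: eqP => [vc|]; last by rewrite mulr0.
  move: (phiP u) (phiP v) uv; rewrite uc vc => /andP[? ?] /andP[? ?].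
  by rewrite ltNge ler_norml => /negP[]; apply/andP; split; nra.
have step2 : 2^-1 <= \sum_c f c.
  have -> : \sum_c f c = bern r s (fun v => \sum_(c < K) (phi v == c%:Z)%:R) 0.
    by rewrite bern_sum.
  (* Chebyshev: the parabola [1 - (v - mu)^2 / w^2] lies below the indicator of the covered
     interval, and the variance is at most [w^2 / 2]. *)
  apply: le_trans (_ : bern r s (fun v => 1 + - w ^- 2 * (v - mu) ^+ 2) 0 <= _).
    rewrite bernD bernZ bern_cst bern_sqr add0r subrr expr0n add0r.
    have w2 : 0 < w ^+ 2 by rewrite exprn_gt0.
    have -> : r * (1 - r) = q / 2 by rewrite -rq; field.
    suff : w ^- 2 * (q / 2 * \sum_(a <- s) a ^+ 2) <= 2^-1 by lra.
    by rewrite mulrC ler_pdivrMr //; move: var_le; rewrite -/w; lra.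
  apply: le_bern => // v; have := phiP v; case: (phi v) => [m|m] /andP[v1 v2].
    have [mK|mK] := ltnP m K.
      rewrite (bigD1 (Ordinal mK)) //= eqxx lerD //.
      apply: le_trans (_ : 0 <= _); last by rewrite sumr_ge0.
      by rewrite mulNr oppr_le0 mulr_ge0 ?sqr_ge0 ?invr_ge0 ?exprn_ge0 ?ltW.
    apply: le_trans (sumr_ge0 _ _); last by move=> *; rewrite ler0n.
    rewrite mulNr subr_le0 mulrC ler_pdivlMr ?exprn_gt0 // mul1r.
    have : K%:R * t <= m%:R * t by rewrite (ler_pM2r t0) ler_nat.
    move: v1; rewrite /w in w0 *; rewrite -pmulrn => v1 v3.
    by rewrite ler_pXn2r // ?nnegrE; lra.
  apply: le_trans (sumr_ge0 _ _); last by move=> *; rewrite ler0n.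
  rewrite mulNr subr_le0 mulrC ler_pdivlMr ?exprn_gt0 // mul1r.
  have v3 : (Negz m)%:~R + 1 <= 0 :> R.
    by rewrite NegzE mulrNz -pmulrn -natr1 opprD addrNK oppr_le0 ler0n.
  have : v - mu <= - w by nra.
  by move=> vw; rewrite -[leRHS]sqrrN ler_pXn2r // ?nnegrE; lra.
apply: le_trans step1.
(* Cauchy-Schwarz by completing a square: [(f - 1/(2K))^2 >= 0] gives [f^2 >= f/K - 1/(4K^2)], and
   the sum over the cells is at least [1/(2K) - 1/(4K)]. *)
apply: le_trans (_ : \sum_c (f c / K%:R - (4 * K%:R ^+ 2)^-1) <= _).
  rewrite sumrB -mulr_suml sumr_const card_ord.
  have -> : (4 * K%:R ^+ 2)^-1 *+ K = (4 * K%:R)^-1 :> R.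
    by rewrite -mulr_natr; field; rewrite gt_eqF.
  have : 2^-1 / K%:R <= (\sum_c f c) / K%:R by rewrite ler_wpM2r ?invr_ge0 ?ler0n.
  have -> : 2^-1 / K%:R = 2 * (4 * K%:R)^-1 :> R by field; rewrite gt_eqF.
  by lra.
apply: ler_sum => c _; have := sqr_ge0 (f c - (2 * K%:R)^-1).
have -> : (f c - (2 * K%:R)^-1) ^+ 2 = f c ^+ 2 - (f c / K%:R - (4 * K%:R ^+ 2)^-1).
  by field; rewrite gt_eqF.
by rewrite subr_ge0.
Qed.

End Walk.

(** * Elementary inequalities *)

Section Elementary.
Variable R : realType.

Lemma bernoulli_le (x : R) n : 0 <= x <= 1 -> 1 - n%:R * x <= (1 - x) ^+ n.
Proof.
move=> /andP[x0 x1]; elim: n => [|n IH]; first by rewrite mul0r subr0.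
rewrite exprS; apply: le_trans (ler_wpM2l _ IH); last by rewrite subr_ge0.
by rewrite -natr1; have := ler0n R n; nra.
Qed.

(** The induction rests on [(1 - x) * (1 + (n + 1) * x) <= 1 + n * x]. *)
Lemma expr_1B_le (x : R) n : 0 <= x <= 1 -> (1 - x) ^+ n <= (1 + n%:R * x)^-1.
Proof.
move=> /andP[x0 x1]; have n0 := ler0n R n.
have nx : 0 < 1 + n%:R * x by nra.
rewrite -[leRHS]mul1r ler_pdivlMr //; elim: n {n0} nx => [|n IH] nx.
  by rewrite mul0r addr0 mulr1.
have n0 := ler0n R n; have nx' : 0 < 1 + n%:R * x by nra.
apply: le_trans (IH nx'); rewrite exprS -mulrA mulrCA ler_wpM2l ?exprn_ge0 ?subr_ge0 //.
by rewrite -natr1; nra.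
Qed.

(** Bernoulli's inequality with exponent [B] would only give [0]. With exponent [uphalf B] it gives
    at least [1/3], which is then squared. *)
Lemma expr_1Binv_ge (B : nat) : (3 <= B)%N -> 9^-1 <= (1 - B%:R^-1 :> R) ^+ B.
Proof.
move=> B3; have B0 : 3 <= B%:R :> R by rewrite (ler_nat R 3).
have x0 : 0 <= B%:R^-1 :> R by rewrite invr_ge0 ler0n.
have x1 : B%:R^-1 <= 1 :> R by rewrite invf_le1; lra.
have := @bernoulli_le B%:R^-1 (uphalf B); rewrite x0 x1 => /(_ isT) le_h.
have h3 : 3^-1 <= 1 - (uphalf B)%:R / B%:R :> R.
  have : (uphalf B)%:R * 2 <= B%:R + 1 :> R.
    by rewrite -natrM natr1 ler_nat; lia.
  rewrite lerBrDr -lerBrDl ler_pdivrMr; lra.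
apply: le_trans (_ : ((1 - B%:R^-1) ^+ uphalf B) ^+ 2 <= _).
  have -> : 9^-1 = (3^-1) ^+ 2 :> R by field.
  by rewrite ler_pXn2r ?nnegrE ?exprn_ge0 //; lra.
by rewrite -exprM ler_wiXn2l //; [lra | lra | lia].
Qed.

(* The summands are bounded by the increments of [4 y m / (m + y)]. *)
Lemma sum_min_sqr_le (y : R) n : 0 < y ->
  \sum_(j < n) Num.min 1 ((y / j.+1%:R) ^+ 2) <= 4 * y.
Proof.
move=> y0; have n0 m := ler0n R m.
apply: (@le_trans _ _ (4 * y * n%:R / (n%:R + y))); last first.
  by rewrite ler_pdivrMr; have := n0 n; nra.
elim: n => [|n IH]; first by rewrite big_ord0 mulr0 mul0r.
rewrite big_ord_recr /=; apply: le_trans (lerD IH (lexx _)) _.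
have m0 := n0 n; rewrite -[n.+1%:R]natr1; set m := n%:R in m0 *.
rewrite -lerBrDl.
have -> : 4 * y * (m + 1) / (m + 1 + y) - 4 * y * m / (m + y) =
    4 * y ^+ 2 / ((m + 1 + y) * (m + y)).
  by field; rewrite !gt_eqF //; lra.
have d0 : 0 < (m + 1 + y) * (m + y) by nra.
have m1 : 0 < m + 1 by lra.
have ym : 0 <= y / (m + 1) by rewrite divr_ge0 // ltW.
rewrite minEle; case: (lerP 1 ((y / (m + 1)) ^+ 2)) => h.
  rewrite ler_pdivlMr // mul1r.
  have my : m + 1 <= y.
    by move: h; rewrite expr_ge1 // ler_pdivlMr // mul1r.
  by nra.
have my : y < m + 1.
  by move: h; rewrite expr_lt1 // ltr_pdivrMr // mul1r.
rewrite expr_div_n ler_pdivrMr ?exprn_gt0 // mulrAC ler_pdivlMr //.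
have : (m + 1 + y) * (m + y) <= 4 * (m + 1) ^+ 2 by nra.
by move/(ler_wpM2l (sqr_ge0 y)); lra.
Qed.

Lemma prod_le_expr_count (s : seq R) (f : R -> R) (P : pred R) (b : R) :
  (forall a, 0 <= f a <= 1) -> 0 <= b -> (forall a, P a -> f a <= b) ->
  \prod_(a <- s) f a <= b ^+ count P s.
Proof.
move=> f01 b0 fb; elim: s => [|a s IH] /=; first by rewrite big_nil.
rewrite big_cons exprD ler_pM //; have /andP[//= f0 f1] := f01 a.
  by rewrite prodr_ge0 // => c _; have /andP[] := f01 c.
by case Pa: (P a); [rewrite expr1 fb|].
Qed.

Lemma cos_half_lt1 : cos 2^-1 < 1 :> R.
Proof.
have pi2 := pi_ge2 R; rewrite -[ltRHS](@cos0 R) ltr_cos ?invr_gt0 //.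
  by rewrite in_itv /=; apply/andP; split; lra.
by rewrite in_itv /=; apply/andP; split; lra.
Qed.

Lemma cos_le_half (x : R) : 2^-1 <= x <= 1 -> cos x <= cos 2^-1.
Proof.
move=> /andP[x0 x1]; have pi2 := pi_ge2 R; rewrite leNgt ltr_cos -?leNgt //.
  by rewrite in_itv /=; apply/andP; split; lra.
by rewrite in_itv /=; apply/andP; split; lra.
Qed.

(** Converts a bound [rho] on the mean of [cos y] into [(1 - rho) / 4] as a lower bound for the
    probability of [d < |y|]. With [d = acos ((1 + rho) / 2)] the left side is nonpositive for
    [|y| <= d], and it never exceeds [1]. *)
Lemma cos_gap (rho : R) : -1 <= rho < 1 -> exists2 d : R, 0 < d &
  forall y, ((1 + rho) / 2 - cos y) / 2 <= (d < `|y|)%R%:R.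
Proof.
move=> /andP[r0 r1]; have h : -1 <= (1 + rho) / 2 <= 1 by apply/andP; split; lra.
exists (acos ((1 + rho) / 2)); first by apply: acos_gt0; apply/andP; split; lra.
move=> y; case: (ltrP (acos ((1 + rho) / 2)) `|y|) => [_|yd]; first by rewrite mulr1n; have := cos_geN1 y; lra.
suff : (1 + rho) / 2 <= cos y by rewrite mulr0n; lra.
rewrite -{1}(acosK h) -(cos_norm y) leNgt ltr_cos -?leNgt // in_itv /=.
  by rewrite acos_ge0 // acos_lepi.
by rewrite normr_ge0 (le_trans yd) // acos_lepi.
Qed.

End Elementary.

(** * The error of one row *)

Section Items.
Variable R : realType.
Implicit Types (n B : nat).

Definition items n (i : 'I_n) : seq R := [seq zipf R j | j <- enum 'I_n & j != i].

Lemma sum_items_le n (i : 'I_n) (F : R -> R) : (forall a, 0 <= F a) ->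
  \sum_(a <- items i) F a <= \sum_(j < n) F j.+1%:R^-1.
Proof.
move=> F0; rewrite big_map big_filter big_enum_cond /= [leRHS](bigD1 i) //=.
by rewrite ler_wpDl.
Qed.

Lemma count_items n (i : 'I_n) (P : pred R) :
  count P (items i) = (\sum_(j < n | j != i) P (j.+1%:R^-1)%R)%N.
Proof.
rewrite count_map count_filter -sum1_count big_enum_cond /=.
rewrite big_mkcond [RHS]big_mkcond; apply: eq_bigr => j _ /=.
by rewrite /zipf; case: (P _); case: (j == i).
Qed.

Lemma sum_ord_itv (a b n : nat) : (\sum_(j < n) (a <= j < b))%N = (minn n b - a)%N.
Proof. by elim: n => [|n IH]; rewrite ?big_ord0 ?big_ord_recr /= ?IH; lia. Qed.

Lemma count_items_gt B n (i : 'I_n) : (0 < B)%N ->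
  (count (fun a : R => B%:R^-1 < a)%R (items i) <= B)%N.
Proof.
move=> B0; rewrite count_items.
apply: (@leq_trans (\sum_(j < n) (0 <= j < B))); last by rewrite sum_ord_itv; lia.
rewrite [leqRHS](bigD1 i) //=; apply: leq_trans (leq_addl _ _).
apply: leq_sum => j _; rewrite ltf_pV2 ?posrE ?ltr0n // ltr_nat.
by case: (ltnP j.+1 B) => // /ltnW ->.
Qed.

(** The [M + 1] items of ranks [M] to [2 * M] qualify, and removing [i] costs at most one of
    them. *)
Lemma count_items_itv (M n : nat) (i : 'I_n) : (0 < M)%N -> (2 * M <= n)%N ->
  (M <= count (fun a : R => 2^-1 <= M%:R * a <= 1)%R (items i))%N.
Proof.
move=> M0 Mn; rewrite count_items.
have : (M.+1 <= \sum_(j < n) (M.-1 <= j < 2 * M))%N by rewrite sum_ord_itv; lia.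
rewrite (bigD1 i) //=; set S := (\sum_(_ < _ | _) _)%N => leS.
apply: (@leq_trans S); first by move: leS; case: (_ && _); lia.
apply: leq_sum => j _; case: andP => // -[j1 j2]; rewrite lt0b.
have j0 : 0 < j.+1%:R :> R by rewrite ltr0n.
rewrite ler_pdivrMr // mul1r ler_pdivlMr // mulrC ler_pdivrMr ?ltr0n //.
by rewrite -natrM !ler_nat; lia.
Qed.

Section OneRow.
Variables (n B : nat) (i : 'I_n).
Hypothesis B3 : (3 <= B)%N.

Let B0 : 0 < B%:R :> R. Proof. by rewrite ltr0n; lia. Qed.

Let q01 : 0 <= (B%:R : R)^-1 <= 2^-1.
Proof.
by rewrite invr_ge0 ltW //= lef_pV2 ?posrE // (ler_nat R 2); lia.
Qed.

(** The truncated variance at threshold [t / B] is the sum of [min(1, (y / j)^2)] with [y = B / t],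
    hence at most [4 * B / t]; the factor [q = 1 / B] remains. *)
Lemma row_tail (t : R) : 0 < t ->
  walk B%:R^-1 (items i) (fun y => (t / B%:R < `|y|)%R%:R) 0 <= 4 / t.
Proof.
move=> t0; have tB : 0 < t / B%:R by rewrite divr_gt0.
apply: le_trans (walk_tail _ _ _ tB) _.
  by move: q01 => /andP[-> h] /=; lra.
rewrite expr0n mul0r add0r mulrC ler_pdivrMr //.
have -> : 4 / t * B%:R = 4 * (B%:R / t) by field; rewrite gt_eqF.
apply: le_trans (sum_min_sqr_le n (divr_gt0 B0 t0)).
apply: le_trans (sum_items_le _ _) _.
  by move=> a; rewrite le_min ler01 divr_ge0 ?sqr_ge0.
apply: ler_sum => j _.
rewrite (_ : _ / _ = (B%:R / t / j.+1%:R) ^+ 2) //.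
by field; rewrite nat1r !gt_eqF // ltr0n.
Qed.

(** With probability at least [1/9] no item of frequency above [1 / B] collides with [i]. The
    remaining items have variance at most [4 / B^2], so about [4 / t] cells of length [t / B]
    suffice for [walk_concentration]. *)
Lemma row_concentration (t : R) : 0 < t <= 1 ->
  t / 180 <= walk B%:R^-1 (items i) (fun y => (`|y| <= t / B%:R)%R%:R) 0.
Proof.
move=> /andP[t0 t1]; have /andP[q0 q1] := q01; have tB : 0 < t / B%:R by rewrite divr_gt0.
pose big (a : R) := B%:R^-1 < a.
apply: le_trans (walk_drop big _ _ _ _); last 2 first.
- by rewrite q0 /=; lra.
- by move=> y; rewrite ler0n.
(* [4 / t <= K] makes the cells long enough in total, and [K <= 5 / t] gives the final constant
   [180 = 9 * 4 * 5]. *)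
pose K := (Num.truncn (4 / t)).+1.
have t4 : 0 <= 4 / t by rewrite divr_ge0 // ltW.
have K1 : 4 / t <= K%:R by rewrite ltW // truncnS_gt.
have K2 : K%:R <= 5 / t.
  have -> : K%:R = (Num.truncn (4 / t))%:R + 1 :> R by rewrite natr1.
  have := truncn_le (4 / t); rewrite t4; have : 1 <= t^-1 by rewrite invf_ge1.
  by lra.
have sq : B%:R^-1 * \sum_(a <- filter (predC big) (items i)) a ^+ 2 <=
    (K%:R * (t / B%:R) / 2) ^+ 2.
  apply: (@le_trans _ _ (4 / B%:R ^+ 2)); last first.
    have -> : (K%:R * (t / B%:R) / 2) ^+ 2 = (K%:R * t / 2) ^+ 2 / B%:R ^+ 2.
      by field; rewrite gt_eqF.
    rewrite ler_wpM2r ?invr_ge0 ?exprn_ge0 ?ler0n //.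
    have : 4 <= K%:R * t by rewrite -ler_pdivrMr.
    by nra.
  rewrite mulrC ler_pdivrMr //.
  have -> : 4 / B%:R ^+ 2 * B%:R = B%:R ^- 2 * (4 * B%:R) :> R.
    by field; rewrite gt_eqF.
  apply: le_trans (ler_wpM2l _ (sum_min_sqr_le n B0)); last by rewrite invr_ge0 exprn_ge0 ?ler0n.
  rewrite big_filter big_mkcond mulr_sumr.
  apply: le_trans (sum_items_le _ _) _; first by move=> a; case: ifP => // _; exact: sqr_ge0.
  apply: ler_sum => j _; rewrite /big /= -leNgt minEle; case: ifP => [jB|_].
    have Bj : B%:R / j.+1%:R <= 1 :> R by rewrite ler_pdivrMr ?ltr0n // mul1r -lef_pV2 ?posrE.
    have j0 : 0 <= B%:R / j.+1%:R :> R by rewrite divr_ge0 ?ler0n.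
    case: ifP => [_|_].
      by rewrite mulr1 -exprVn ler_pXn2r ?nnegrE ?invr_ge0 ?ler0n.
    rewrite (_ : _ * _ = j.+1%:R^-1 ^+ 2) //.
    by field; rewrite nat1r !gt_eqF // ltr0n.
  by rewrite mulr_ge0 ?invr_ge0 ?exprn_ge0 ?ler0n //; case: ifP; rewrite ?ler01 ?sqr_ge0.
have cK := walk_concentration q01 tB (ltn0Sn _) sq.
apply: (@le_trans _ _ (9^-1 * (4 * K%:R)^-1)).
  have K0 : 0 < K%:R :> R by rewrite ltr0n.
  rewrite invfM mulrA -[leRHS]mul1r mulrA ler_pdivlMr //.
  have : t * K%:R <= 5 by rewrite mulrC -ler_pdivlMr.
  by lra.
rewrite ler_pM ?invr_ge0 ?mulr_ge0 ?ler0n //.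
apply: le_trans (expr_1Binv_ge R B3) _.
by rewrite ler_wiXn2l ?count_items_gt //; [lra | lra | lia].
Qed.

(** At frequency [B * m] at least [B * m] items have an angle in [[1/2, 1]], and each contributes a
    factor at most [b = 1 - (1 - cos (1/2)) / B]. Moreover [b ^+ B <= 1 / (2 - cos (1/2))]. *)
Lemma row_fourier (m : nat) : (0 < m)%N -> (2 * (B * m) <= n)%N ->
  walk B%:R^-1 (items i) (fun y => cos ((B * m)%:R * y)) 0 <=
  (2 - cos 2^-1 : R) ^- m.
Proof.
move=> m0 mn; have /andP[q0 q1] := q01; rewrite walk_cos mulr0 cos0 mul1r.
have c1 := cos_half_lt1 R; have c0 := cos_geN1 (2^-1 : R).
have BM : (0 < B * m)%N by nia.
pose b : R := 1 - B%:R^-1 * (1 - cos 2^-1).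
have b0 : 0 <= b by rewrite /b; nra.
apply: le_trans (_ : b ^+ (B * m) <= _).
  apply: le_trans (prod_le_expr_count _ (P := fun a : R => 2^-1 <= (B * m)%:R * a <= 1) _ b0 _) _.
  - move=> a; have := cos_geN1 ((B * m)%:R * a); have := cos_le1 ((B * m)%:R * a).
    by move=> h1 h2; apply/andP; split; nra.
  - by move=> a /cos_le_half; rewrite /b; nra.
  rewrite ler_wiXn2l ?count_items_itv //; rewrite /b; nra.
rewrite exprM -exprVn; apply: lerXn2r; rewrite ?nnegrE ?exprn_ge0 ?invr_ge0 //; first by lra.
apply: le_trans (expr_1B_le _ _) _; first by apply/andP; split; nra.
have -> : B%:R * (B%:R^-1 * (1 - cos 2^-1)) = 1 - cos 2^-1 :> R by field; rewrite gt_eqF.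
by rewrite lef_pV2 ?posrE; lra.
Qed.

End OneRow.

End Items.

(** * The law of the error of a row *)

Section RowLaw.
Variables (R : realType) (n B : nat) (i : 'I_n).
Hypothesis B0 : (0 < B)%N.

(** Bucket and sign are paired so that distinct items are independent coordinates of a single
    function. *)
Definition sketch_row : finType := {ffun 'I_n -> 'I_B * bool}.

Definition row_error (r : sketch_row) : R :=
  \sum_(j <- enum 'I_n | j != i)
    ((r j).1 == (r i).1)%:R * (-1) ^+ (r i).2 * (-1) ^+ (r j).2 * zipf R j.

Let cardB : (0 < #|{: 'I_B * bool}|)%N.
Proof. by rewrite card_prod card_ord card_bool muln_gt0 B0. Qed.

Lemma card_sketch_row_gt0 : (0 < #|sketch_row|)%N.
Proof. by rewrite card_ffun expn_gt0 cardB. Qed.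

(** Whatever the bucket and sign [o] of [i], another item collides with probability [1 / B], and the
    product of the two signs is uniform. *)
Lemma mean_step (o : 'I_B * bool) (H : R -> R) (x a : R) :
  mean (fun o' : 'I_B * bool =>
    H (x + (o'.1 == o.1)%:R * (-1) ^+ o.2 * (-1) ^+ o'.2 * a)) =
  (1 - B%:R^-1) * H x + B%:R^-1 / 2 * (H (x + a) + H (x - a)).
Proof.
case: o => b c /=; rewrite mean_prod.
pose u := (H (x + a) + H (x - a)) / 2.
rewrite (eq_mean (Y := fun b' => if b' == b then u else H x)) => [|b'].
  rewrite /mean (bigD1 b) //= eqxx (eq_bigr (fun=> H x)) => [|b' /negPf -> //].
  rewrite sumr_const cardC1 card_ord -[_ *+ _]mulr_natr -subn1 natrB // /u.
  by field; rewrite pnatr_eq0 -lt0n.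
rewrite /mean big_bool card_bool /= expr0 expr1 /u; case: eqP => _.
  by case: c; rewrite ?expr0 ?expr1 !(mul1r, mulr1, mulN1r, mulrN1, opprK) // [H (x - a) + _]addrC.
by rewrite !mul0r addr0; field.
Qed.

(** Conditionally on the value [o] at [i], the other items make independent lazy steps whose law
    does not depend on [o]. *)
Lemma mean_row_error (F : R -> R) :
  mean (fun r => F (row_error r)) = walk B%:R^-1 (items R i) F 0.
Proof.
rewrite -(mean_resample i) //.
rewrite -[RHS](mean_cst _ cardB); apply: eq_mean => o.
pose g (j : 'I_n) (o' : 'I_B * bool) : R :=
  (o'.1 == o.1)%:R * (-1) ^+ o.2 * (-1) ^+ o'.2 * zipf R j.
pose s := [seq j <- enum 'I_n | j != i].
transitivity (iter_mean g s F 0).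
  have us : uniq s by rewrite filter_uniq ?enum_uniq.
  rewrite -mean_sum_coord //; apply: eq_mean => r.
  rewrite add0r big_filter; congr F; apply: eq_bigr => j /negPf ji.
  by rewrite /ffun_set !ffunE eqxx ji.
rewrite /items -/s; elim: s 0 => //= j s IH x.
by rewrite -!IH -(mean_step o (iter_mean g s F)).
Qed.

Lemma mean_row_error_opp (F : R -> R) :
  mean (fun r => F (- row_error r)) = mean (fun r => F (row_error r)).
Proof.
by rewrite (mean_row_error (fun y => F (- y))) mean_row_error -walk_opp oppr0.
Qed.

End RowLaw.

(** * The median and majorities *)

Section Median.
Variable R : realType.

(** In the sorted list the entries satisfying an upward closed [P] form a final segment, which
    contains the middle index [m] exactly when it has more than [m] elements. *)
Lemma median_up (P : pred R) (t : seq R) (m : nat) : size t = m.*2.+1 ->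
  (forall x y, x <= y -> P x -> P y) -> P (median t) = (m < count P t)%N.
Proof.
move=> st Pup; rewrite /median st.
have -> : m.*2.+1./2 = m by lia.
have -> : count P t = count P (sort <=%R t) by apply/permP; rewrite perm_sym perm_sort.
have ss : size (sort <=%R t) = m.*2.+1 by rewrite size_sort.
have sorted_s : sorted <=%R (sort <=%R t) by apply: sort_sorted; exact: le_total.
move: (sort <=%R t) ss sorted_s => s ss sorted_s {t st}.
have mono a b : (a <= b)%N -> (b < m.*2.+1)%N -> nth 0 s a <= nth 0 s b.
  move=> ab bs; apply: (sorted_leq_nth le_trans le_refl 0 sorted_s); rewrite ?inE ?ss //; lia.
case Pm: (P _); apply/esym; last apply/negbTE; rewrite -?leqNgt.
  rewrite -[X in count P X](cat_take_drop m) count_cat.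
  suff -> : count P (drop m s) = m.+1 by lia.
  have /eqP : all P (drop m s) == true.
    apply/eqP/(all_nthP 0) => a; rewrite size_drop nth_drop ss => am.
    by apply: Pup Pm; apply: mono; lia.
  by rewrite all_count => /eqP ->; rewrite size_drop ss; lia.
rewrite -[X in count P X](cat_take_drop m.+1) count_cat.
suff -> : count P (take m.+1 s) = 0%N.
  by rewrite add0n; apply: leq_trans (count_size _ _) _; rewrite size_drop ss; lia.
apply/eqP; rewrite -leqn0 leqNgt -has_count; apply/hasPn => x /(nthP 0)[a].
rewrite size_takel ?ss; last by lia.
move=> am <-; rewrite nth_take //; apply/negP => Pa; move/negP: Pm; apply.
by apply: Pup Pa; apply: mono; lia.
Qed.

Lemma median_down (P : pred R) (t : seq R) (m : nat) : size t = m.*2.+1 ->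
  (forall x y, x <= y -> P y -> P x) -> P (median t) = (m < count P t)%N.
Proof.
move=> st Pdown; apply/negb_inj.
rewrite (@median_up (fun x => ~~ P x) _ _ st) => [|x y xy]; last by apply/contra/Pdown.
have := count_predC P t; rewrite st -[count (fun x => ~~ P x) t]/(count (predC P) t).
by lia.
Qed.

End Median.

(** * The sketch as a family of independent rows *)

Section Sketch.
Variables (R : realType) (k n B : nat) (i : 'I_n).
Local Notation rows := {ffun 'I_k -> sketch_row n B}.

(** Regroups the random functions by row; as a bijection it preserves the uniform law. *)
Definition sketch_of_rows (W : rows) : sketch k n B :=
  ([ffun l => [ffun j => (W l j).1]], [ffun l => [ffun j => (W l j).2]]).

Lemma sketch_of_rows_bij : bijective sketch_of_rows.
Proof.
exists (fun w : sketch k n B => [ffun l => [ffun j => (w.1 l j, w.2 l j)]] : rows).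
  by move=> W; apply/ffunP => l; apply/ffunP => j; rewrite !ffunE -surjective_pairing.
by case=> h s; congr (_, _); apply/ffunP => l; apply/ffunP => j; rewrite !ffunE.
Qed.

(** Item [i] always collides with itself, and its squared sign is [1]; this isolates the true
    frequency. *)
Lemma row_estimate_error (W : rows) (l : 'I_k) :
  row_estimate R (sketch_of_rows W) i l = row_error R i (W l) + zipf R i.
Proof.
rewrite /row_estimate /row_error /sgn /hash (bigD1 i) //= !ffunE eqxx mul1r.
rewrite mulrDr mulrA -expr2 sqrr_sign mul1r addrC; congr (_ + _).
rewrite big_enum_cond mulr_sumr; apply: eq_bigr => j _; rewrite !ffunE.
by ring.
Qed.

Definition median_error (W : rows) : R :=
  count_sketch R (sketch_of_rows W) i - zipf R i.

Lemma expected_errorE : expected_error R k B i = mean (fun W => `|median_error W|).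
Proof. by rewrite /expected_error -(mean_bij _ sketch_of_rows_bij). Qed.

Definition row_count (P : pred R) (W : rows) : nat :=
  (\sum_(l < k) P (row_error R i (W l)))%N.

Lemma count_row_estimate (P Q : pred R) (W : rows) :
  (forall x, Q (x + zipf R i) = P x) ->
  count Q [seq row_estimate R (sketch_of_rows W) i l | l <- enum 'I_k] = row_count P W.
Proof.
move=> QP; rewrite count_map -sum1_count big_enum_cond big_mkcond /=.
apply: eq_bigr => l _ /=; rewrite -QP -row_estimate_error.
by case: (Q _).
Qed.

Lemma median_error_gt (m : nat) (W : rows) (t : R) : k = m.*2.+1 ->
  (t < median_error W) = (m < row_count (fun x => t < x)%R W)%N.
Proof.
move=> km; rewrite -(@count_row_estimate _ (fun x => t < x - zipf R i)) => [|x].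
  rewrite -median_up //; first by rewrite size_map size_enum_ord.
  by move=> x y xy tx; apply: lt_le_trans tx _; rewrite lerD2r.
by rewrite addrK.
Qed.

Lemma median_error_lt (m : nat) (W : rows) (t : R) : k = m.*2.+1 ->
  (median_error W < t) = (m < row_count (fun x => x < t)%R W)%N.
Proof.
move=> km; rewrite -(@count_row_estimate _ (fun x => x - zipf R i < t)) => [|x].
  rewrite -median_down //; first by rewrite size_map size_enum_ord.
  by move=> x y xy tx; apply: le_lt_trans tx; rewrite lerD2r.
by rewrite addrK.
Qed.

End Sketch.

(** * Upper bound *)

Section Tails.
Variables (R : realType) (Omega : finType).
Hypothesis O_gt0 : (0 < #|Omega|)%N.

(* Chernoff bound with the optimal base (1 - p) / p. *)
Lemma mean_majority_le (P : pred Omega) (k m : nat) (p : R) : k = m.*2.+1 ->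
  mean (fun o => (P o)%:R) <= p -> 0 < p <= 2^-1 ->
  mean (fun W : {ffun 'I_k -> Omega} => (m < \sum_l P (W l))%N%:R) <=
  2 * p * (4 * p * (1 - p)) ^+ m.
Proof.
move=> km le_p /andP[p0 p1]; pose z := (1 - p) / p.
have z1 : 1 <= z by rewrite /z ler_pdivlMr // mul1r; lra.
have z0 : 0 < z by lra.
pose f o : R := 1 + (z - 1) * (P o)%:R.
(* The indicator of [m < count] is at most [z ^ (count - m - 1)] because [z >= 1]; the power of [z]
   factors over the rows. *)
apply: (@le_trans _ _ (mean (fun W : {ffun 'I_k -> Omega} => z ^- m.+1 * \prod_l f (W l)))).
  apply: le_mean => W; have -> : \prod_l f (W l) = z ^+ (\sum_l P (W l)).
    rewrite -prodrXr; apply: eq_bigr => l _; rewrite /f.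
    by case: (P _); rewrite ?mulr1 ?mulr0 ?addr0 ?expr0 ?expr1 //; ring.
  have [mW|mW] := ltnP m; last by rewrite mulr_ge0 ?invr_ge0 ?exprn_ge0 ?ltW.
  by rewrite mulrC ler_pdivlMr ?exprn_gt0 // mul1r ler_weXn2l.
rewrite meanZ (mean_prod_coord (fun=> f)) prodr_const card_ord meanD meanZ mean_cst //.
have m0 : 0 <= mean (fun o => (P o)%:R) :> R by apply: mean_ge0 => o; rewrite ler0n.
apply: (@le_trans _ _ (z ^- m.+1 * (2 * (1 - p)) ^+ k)).
  rewrite ler_wpM2l ?invr_ge0 ?exprn_ge0 ?(ltW z0) // lerXn2r ?nnegrE //.
  - by apply: addr_ge0 => //; apply: mulr_ge0 => //; rewrite subr_ge0.
  - by lra.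
  have -> : 2 * (1 - p) = 1 + (z - 1) * p by rewrite /z; field; rewrite gt_eqF.
  by rewrite lerD2l ler_wpM2l // subr_ge0.
have p1' : 1 - p != 0 by rewrite gt_eqF //; lra.
have -> : (2 * (1 - p)) ^+ k = 2 * (1 - p) * (4 * (1 - p) ^+ 2) ^+ m.
  by rewrite km exprS -[m.*2]mul2n exprM; congr (_ * _ ^+ _); ring.
rewrite -exprVn exprS mulrACA -exprMn /z le_eqVlt; apply/orP; left; apply/eqP.
by congr (_ * _ ^+ _); field; rewrite ?p1' gt_eqF.
Qed.

Lemma le_layers (J : nat) (y : R) : y <= J%:R -> y <= \sum_(j < J) (j%:R < y)%R%:R.
Proof.
elim: J => [|J IH] yJ; first by rewrite big_ord0.
have [/IH yJ'|Jy] := lerP y J%:R.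
  by rewrite big_ord_recr /=; apply: le_trans yJ' _; rewrite lerDl ler0n.
apply: le_trans yJ _; rewrite (eq_bigr (fun=> 1)) ?sumr_const ?card_ord //.
move=> j _; rewrite (le_lt_trans _ Jy) // ler_nat -ltnS; exact: ltn_ord.
Qed.

(** Layer-cake summation: layer [0] costs at most [1], and [1 / j^2 <= 2 * (1 / j - 1 / (j + 1))]
    telescopes over the others. Finiteness of [Omega] bounds [Y], so finitely many layers
    suffice. *)
Lemma mean_le_of_tail (Y : Omega -> R) (C : R) : 0 <= C ->
  (forall j : nat, (0 < j)%N -> mean (fun w => (j%:R < Y w)%R%:R) <= C / j%:R ^+ 2) ->
  mean Y <= 1 + 2 * C.
Proof.
move=> C0 tail.
pose J := (Num.truncn (\sum_w `|Y w|)).+1.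
have YJ w : Y w <= J%:R.
  apply: le_trans (ltW (truncnS_gt _)); apply: le_trans (ler_norm _) _.
  by rewrite (bigD1 w) //= lerDl sumr_ge0.
apply: le_trans (le_mean (fun w => le_layers (YJ w))) _; rewrite mean_sum.
apply: (@le_trans _ _ (1 + 2 * C * (1 - J%:R^-1))); last first.
  by rewrite lerD2l ler_piMr ?mulr_ge0 // gerBl invr_ge0 ler0n.
rewrite /J; elim: (Num.truncn _) => [|j IH].
  rewrite big_ord1 invr1 subrr mulr0 addr0 -[leRHS](mean_cst 1 O_gt0).
  by apply: le_mean => w; rewrite lern1 leq_b1.
rewrite big_ord_recr /=; apply: le_trans (lerD IH (tail _ (ltn0Sn j))) _.
rewrite -addrA lerD2l; have j1 : 1 <= j.+1%:R :> R by rewrite ler1n.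
rewrite -[j.+2%:R]natr1; set x : R := j.+1%:R in j1 *.
rewrite -subr_ge0.
have -> : 2 * C * (1 - (x + 1)^-1) - (2 * C * (1 - x^-1) + C / x ^+ 2) =
    C * (x - 1) / (x ^+ 2 * (x + 1)) by field; rewrite !gt_eqF //; lra.
by rewrite divr_ge0 ?mulr_ge0 ?exprn_ge0 ?subr_ge0 //; lra.
Qed.

End Tails.

(** * Tail of the median error and its integration *)

Section Upper.
Variables (R : realType) (k n B m : nat) (i : 'I_n).
Hypotheses (B3 : (3 <= B)%N) (km : k = m.*2.+1) (m1 : (1 <= m)%N).

Let B0 : (0 < B)%N. Proof. exact: leq_trans B3. Qed.

Local Notation err := (@row_error R n B i).

Lemma mean_err_lt (t : R) :
  mean (fun r => (err r < - t)%R%:R) = mean (fun r => (t < err r)%R%:R) :> R.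
Proof.
rewrite -(mean_row_error_opp i B0 (fun y => (t < y)%R%:R)).
by apply: eq_mean => r; rewrite ltrNr.
Qed.

Lemma norm_gt_split (t x : R) : 0 <= t ->
  (t < `|x|)%R%:R = (t < x)%R%:R + (x < - t)%R%:R :> R.
Proof.
move=> t0; rewrite ltr_normr ltrNr.
have [tx|xt] := ltrP t x; last by rewrite add0r.
by rewrite ltNge (_ : - t <= x) ?addr0 //; lra.
Qed.

Lemma mean_err_norm (t : R) : 0 <= t ->
  mean (fun r => (t < `|err r|)%R%:R) = 2 * mean (fun r => (t < err r)%R%:R) :> R.
Proof.
move=> t0; rewrite (eq_mean (fun r => norm_gt_split (err r) t0)) meanD mean_err_lt.
by ring.
Qed.

Lemma mean_err_norm_le (t : R) :
  mean (fun r => (`|err r| <= t)%R%:R) = 1 - mean (fun r => (t < `|err r|)%R%:R) :> R.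
Proof.
rewrite -[X in X - _](mean_cst 1 (card_sketch_row_gt0 n B0)) -meanB; apply: eq_mean => r.
by rewrite ltNge; case: (`|err r| <= t); rewrite ?subr0 ?subrr.
Qed.

(** By symmetry, each one-sided tail is half of the mass that [row_concentration] leaves outside. *)
Lemma mean_err_gt_le (t : R) : 0 < t <= 1 ->
  mean (fun r => (t / B%:R < err r)%R%:R) <= (1 - t / 180) / 2.
Proof.
move=> t01; have /andP[t0 _] := t01; have tB : 0 <= t / B%:R by rewrite divr_ge0 ?ltW ?ltr0n.
have := row_concentration i B3 t01.
rewrite -(mean_row_error i B0 (fun y => (`|y| <= t / B%:R)%R%:R)) mean_err_norm_le mean_err_norm //.
by lra.
Qed.

Lemma mean_err_gt_le_inv (t : R) : 0 < t ->
  mean (fun r => (t / B%:R < err r)%R%:R) <= 2 / t.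
Proof.
move=> t0; have tB : 0 <= t / B%:R by rewrite divr_ge0 ?ltW ?ltr0n.
have := row_tail i B3 t0.
rewrite -(mean_row_error i B0 (fun y => (t / B%:R < `|y|)%R%:R)) mean_err_norm //.
by lra.
Qed.

Lemma median_error_tail_le (t p : R) : 0 <= t ->
  mean (fun r => (t < err r)%R%:R) <= p -> 0 < p <= 2^-1 ->
  mean (fun W : {ffun 'I_k -> sketch_row n B} => (t < `|median_error R i W|)%R%:R) <=
  2 * (2 * p * (4 * p * (1 - p)) ^+ m).
Proof.
move=> t0 le_p p01.
rewrite (eq_mean (fun W => norm_gt_split (median_error R i W) t0)) meanD.
rewrite (_ : 2 * (2 * p * _) = 2 * p * (4 * p * (1 - p)) ^+ m + 2 * p * (4 * p * (1 - p)) ^+ m); last by ring.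
apply: lerD.
  have := mean_majority_le (card_sketch_row_gt0 n B0) (P := fun r => t < err r) km le_p p01.
  by apply: le_trans; apply: le_mean => W; rewrite (median_error_gt _ _ _ km).
have le_p' : mean (fun r => (err r < - t)%R%:R) <= p by rewrite mean_err_lt.
have := mean_majority_le (card_sketch_row_gt0 n B0) (P := fun r => err r < - t) km le_p' p01.
by apply: le_trans; apply: le_mean => W; rewrite (median_error_lt _ _ _ km).
Qed.

(** For [t <= 1] take [p = (1 - t / 180) / 2], so that [4 * p * (1 - p) = 1 - (t / 180)^2]. For
    [t > 1] the decay in [t] comes from two factors [p <= 2 / t], the decay in [k] from the
    remaining [m - 1] factors. *)
Lemma median_error_tail (t : R) : 0 < t ->
  mean (fun W : {ffun 'I_k -> sketch_row n B} => (t / B%:R < `|median_error R i W|)%R%:R) <=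
  192 * 180 ^+ 2 / (k%:R * t ^+ 2).
Proof.
move=> t0; have tB : 0 <= t / B%:R by rewrite divr_ge0 ?ltW ?ltr0n.
have m1' : 1 <= m%:R :> R by rewrite ler1n.
have kE : k%:R = 2 * m%:R + 1 :> R by rewrite km -natr1 -muln2 natrM mulrC.
have kt : 0 < k%:R * t ^+ 2 by rewrite mulr_gt0 ?exprn_gt0 // kE; lra.
have [t1|t1] := lerP t 1.
  have t01 : 0 < t <= 1 by rewrite t0.
  apply: le_trans (median_error_tail_le tB (mean_err_gt_le t01) _) _.
    by apply/andP; split; lra.
  have -> : 4 * ((1 - t / 180) / 2) * (1 - (1 - t / 180) / 2) = 1 - (t / 180) ^+ 2 by field.
  have x01 : 0 <= (t / 180) ^+ 2 <= 1 by apply/andP; split; nra.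
  have := expr_1B_le m x01; set e := (1 - _) ^+ m => le_e.
  have e0 : 0 <= e by rewrite /e exprn_ge0 // subr_ge0; case/andP: x01.
  apply: (@le_trans _ _ (2 * (1 + m%:R * (t / 180) ^+ 2)^-1)).
    by rewrite ler_pM2l //; nra.
  have d0 : 0 < 1 + m%:R * (t / 180) ^+ 2 by nra.
  rewrite ler_pdivrMr // mulrAC ler_pdivlMr // kE.
  by have := mulr_ge0 (le_trans ler01 m1') (sqr_ge0 t); nra.
pose p := Num.min ((1 - 180^-1) / 2) (2 / t) : R.
have p0 : 0 < p by rewrite lt_min; apply/andP; split; [lra | rewrite divr_gt0].
have pt : p <= 2 / t by rewrite ge_min lexx orbT.
have p1 : p <= (1 - 180^-1) / 2 by rewrite ge_min lexx.
have le_p : mean (fun r => (t / B%:R < err r)%R%:R) <= p.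
  rewrite le_min mean_err_gt_le_inv // andbT.
  apply: le_trans (_ : mean (fun r => (1 / B%:R < err r)%R%:R) <= _); last first.
    by apply: le_trans (mean_err_gt_le _) _; rewrite ?ltr01 ?lexx //; lra.
  apply: le_mean => r; rewrite ler_nat; case: ltrP => // tr.
  by rewrite (le_lt_trans _ tr) // ler_wpM2r ?invr_ge0 ?ler0n // ltW.
apply: le_trans (median_error_tail_le tB le_p _) _; first by apply/andP; split; lra.
have x01 : 0 <= (180^-1 : R) ^+ 2 <= 1 by apply/andP; split; nra.
have := expr_1B_le m.-1 x01; set e := (1 - _) ^+ m.-1 => le_e.
have e0 : 0 <= e by rewrite /e exprn_ge0 // subr_ge0; case/andP: x01.
(* One factor is kept as [4 * p] to obtain [p^2] in the end; the others are at most [1 - 1 / 180^2],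
   since [p <= (1 - 1 / 180) / 2]. *)
have h1 : (4 * p * (1 - p)) ^+ m <= 4 * p * e.
  rewrite -(prednK m1) exprS ler_pM ?exprn_ge0 //; try nra.
  by rewrite lerXn2r ?nnegrE; nra.
have m1E : m.-1%:R = m%:R - 1 :> R by rewrite -subn1 natrB.
apply: (@le_trans _ _ (16 * (p ^+ 2 * e))); first by nra.
apply: (@le_trans _ _ (16 * ((2 / t) ^+ 2 * (1 + m.-1%:R * 180^-1 ^+ 2)^-1))).
  rewrite ler_pM2l // ler_pM ?sqr_ge0 // lerXn2r ?nnegrE ?divr_ge0 //; lra.
(* From [m / 180^2 <= D] and [k <= 3 * m] one gets [64 / D <= E / k], with [192 = 3 * 64]. *)
have [D DE] : exists D, D = 1 + (m%:R - 1) * 180^-1 ^+ 2 :> R by eexists.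
have [E EE] : exists E, E = 192 * 180 ^+ 2 :> R by eexists.
rewrite m1E -DE -EE.
have d0 : 0 < D by rewrite DE; nra.
have -> : 16 * ((2 / t) ^+ 2 * D^-1) = 64 / D / t ^+ 2 by field; rewrite !gt_eqF.
have k0 : 0 < k%:R :> R by rewrite kE; lra.
have -> : E / (k%:R * t ^+ 2) = E / k%:R / t ^+ 2 by field; rewrite !gt_eqF.
rewrite ler_wpM2r ?invr_ge0 ?exprn_ge0 ?(ltW t0) // ler_pdivrMr // mulrAC ler_pdivlMr //.
by rewrite kE DE EE; lra.
Qed.

(** Scaled by [B * sqrt k], the error has tail at most [C / j^2] at [j], with [C = 192 * 180^2]:
    this is [median_error_tail] at [t = j / sqrt k]. *)
Lemma expected_error_le :
  expected_error R k B i <= (1 + 384 * 180 ^+ 2) / (B%:R * Num.sqrt k%:R).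
Proof.
rewrite expected_errorE; have B0' : 0 < B%:R :> R by rewrite ltr0n.
have k0 : 0 < k%:R :> R by rewrite ltr0n km.
have s0 : 0 < Num.sqrt k%:R :> R by rewrite sqrtr_gt0.
have Bs : 0 < B%:R * Num.sqrt k%:R :> R by rewrite mulr_gt0.
rewrite ler_pdivlMr // mulrC -meanZ.
have cardW : (0 < #|{ffun 'I_k -> sketch_row n B}|)%N by rewrite card_ffun expn_gt0 card_sketch_row_gt0.
have -> : 1 + 384 * 180 ^+ 2 = 1 + 2 * (192 * 180 ^+ 2) :> R by ring.
apply: mean_le_of_tail => //; first by rewrite mulr_ge0 ?exprn_ge0 ?ler0n.
move=> j j0; have j0' : 0 < j%:R :> R by rewrite ltr0n.
have := median_error_tail (divr_gt0 j0' s0).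
rewrite expr_div_n sqr_sqrtr ?(ltW k0) // [k%:R * _]mulrC divfK ?gt_eqF //.
apply: le_trans; apply: le_mean => W; rewrite ler_nat.
have -> : (j%:R / Num.sqrt k%:R / B%:R < `|median_error R i W|) =
   (j%:R < B%:R * Num.sqrt k%:R * `|median_error R i W|).
  by rewrite !ltr_pdivrMr //; congr (_ < _); ring.
by [].
Qed.

End Upper.

(** * Lower bound *)

Section FourierBounds.
Variables (R : realType) (Omega : finType).
Hypothesis O_gt0 : (0 < #|Omega|)%N.
Implicit Types X : Omega -> R.

Lemma geometric_sum_le (rho : R) N : 0 <= rho < 1 ->
  \sum_(b < N) rho ^+ (N - b) <= rho / (1 - rho).
Proof.
move=> /andP[r0 r1]; have r1' : 0 < 1 - rho by lra.
elim: N => [|N IH]; first by rewrite big_ord0 divr_ge0 // ltW.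
rewrite big_ord_recr /= subSnn expr1.
rewrite (eq_bigr (fun b : 'I_N => rho * rho ^+ (N - b))) => [|b _]; last first.
  by rewrite subSn ?exprS // ltnW.
rewrite -mulr_sumr; apply: le_trans (lerD (ler_wpM2l r0 IH) (lexx _)) _.
by rewrite le_eqVlt; apply/orP; left; apply/eqP; field; rewrite gt_eqF.
Qed.

(** The squared modulus of the exponential sum of [e^(i a x)] over [a < N], in real terms. *)
Definition dirichlet_sqr (N : nat) (x : R) : R :=
  (\sum_(a < N) cos (a%:R * x)) ^+ 2 + (\sum_(a < N) sin (a%:R * x)) ^+ 2.

(** The new unit vector adds its own square [1] and twice its inner products with the earlier ones,
    which are cosines of differences. Thus only positive frequencies below [N + 1] enter. *)
Lemma dirichlet_sqrS N x :
  dirichlet_sqr N.+1 x =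
  dirichlet_sqr N x + (1 + 2 * \sum_(b < N) cos ((N - b)%:R * x)).
Proof.
rewrite /dirichlet_sqr !big_ord_recr /=.
have -> : \sum_(b < N) cos ((N - b)%:R * x) =
    (\sum_(a < N) cos (a%:R * x)) * cos (N%:R * x) +
    (\sum_(a < N) sin (a%:R * x)) * sin (N%:R * x).
  rewrite !mulr_suml -big_split; apply: eq_bigr => b _ /=.
  rewrite natrB; last by rewrite ltnW.
  by rewrite mulrBl cosB [cos _ * _]mulrC [sin _ * _]mulrC.
rewrite -[X in _ + (X + _)](cos2Dsin2 (N%:R * x)).
move: (cos (N%:R * x)) (sin (N%:R * x)) (\sum_(_ < _) cos _) (\sum_(_ < _) sin _) => c s C S.
by ring.
Qed.

(** All angles [a * x] lie in [[-1, 1]], where the cosine is at least [cos 1]. *)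
Lemma dirichlet_sqr_ge N x : (0 < N)%N -> `|x| <= N%:R^-1 ->
  (N%:R * cos 1) ^+ 2 <= dirichlet_sqr N x.
Proof.
move=> N0 xN; have c1 := cos1_gt0 R; have N0' : 0 < N%:R :> R by rewrite ltr0n.
have Nc : 0 <= N%:R * cos 1 :> R by rewrite mulr_ge0 ?ltW.
suff le_sum : N%:R * cos 1 <= \sum_(a < N) cos (a%:R * x).
  rewrite -[leLHS]addr0 lerD ?sqr_ge0 //.
  by apply: lerXn2r => //; rewrite nnegrE // (le_trans Nc).
rewrite mulr_natl -[X in _ *+ X]card_ord -sumr_const; apply: ler_sum => a _.
have pi2 := pi_ge2 R.
have ax : `|a%:R * x| <= 1.
  rewrite normrM normr_nat; apply: le_trans (_ : N%:R * N%:R^-1 <= _).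
    by rewrite ler_pM // ler_nat ltnW.
  by rewrite mulfV ?gt_eqF.
rewrite -(cos_norm (_ * x)) leNgt ltr_cos -?leNgt // in_itv /=.
  by apply/andP; split; lra.
by rewrite normr_ge0; lra.
Qed.

(* The indicator of [|x| <= 1/N] is dominated by the squared Dirichlet kernel
   divided by [(N cos 1)^2]. *)
Lemma mean_small_le X (rho : R) N : 0 <= rho < 1 -> (0 < N)%N ->
  (forall a, (0 < a < N)%N -> mean (fun w => cos (a%:R * X w)) <= rho ^+ a) ->
  mean (fun w => (`|X w| <= N%:R^-1)%R%:R) <= 2 / ((1 - rho) * cos 1 ^+ 2) / N%:R.
Proof.
move=> r01 N0 four; have /andP[r0 r1] := r01.
have c1 := cos1_gt0 R; have N0' : 0 < N%:R :> R by rewrite ltr0n.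
have r1' : 0 < 1 - rho by lra.
have D0 M x : 0 <= dirichlet_sqr M x by rewrite addr_ge0 ?sqr_ge0.
(* Each increase of [N] by one adds at most [1 + 2 * rho / (1 - rho) = 2 / (1 - rho) - 1]. *)
have meanD_le : mean (fun w => dirichlet_sqr N (X w)) <= N%:R * (2 / (1 - rho)).
  elim: N {N0 N0'} four => [|M IH] four.
    rewrite mul0r -[leRHS](mean_cst 0 O_gt0); apply: le_mean => w.
    by rewrite /dirichlet_sqr !big_ord0 expr0n addr0.
  rewrite (eq_mean (fun w => dirichlet_sqrS M (X w))) meanD [mean (fun w => 1 + _)]meanD meanZ mean_sum mean_cst //.
  have -> : M.+1%:R * (2 / (1 - rho)) = M%:R * (2 / (1 - rho)) + 2 / (1 - rho).
    by rewrite -natr1; ring.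
  apply: lerD; first by apply: IH => a /andP[a0 aM]; rewrite four // a0 ltnW.
  apply: le_trans (_ : 1 + 2 * (rho / (1 - rho)) <= _).
    rewrite lerD2l ler_pM2l //; apply: le_trans (geometric_sum_le M r01).
    by apply: ler_sum => b _; apply: four; rewrite subn_gt0 ltn_ord ltnS leq_subr.
  by rewrite -subr_ge0 (_ : _ - _ = 1) //; field; rewrite gt_eqF.
have Nc : 0 < (N%:R * cos 1) ^+ 2 :> R by rewrite exprn_gt0 ?mulr_gt0.
apply: (@le_trans _ _ ((N%:R * cos 1) ^- 2 * mean (fun w => dirichlet_sqr N (X w)))).
  rewrite -meanZ; apply: le_mean => w; case: (lerP `|X w| N%:R^-1) => [xN|_].
    by rewrite mulrC ler_pdivlMr // mul1r dirichlet_sqr_ge.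
  by rewrite mulr_ge0 // invr_ge0 ltW.
apply: le_trans (ler_wpM2l _ meanD_le) _; first by rewrite invr_ge0 ltW.
by rewrite le_eqVlt; apply/orP; left; apply/eqP; field; rewrite !gt_eqF.
Qed.

(** The sum has [k] independent steps, equal to [1] and [-1] with probability [p] each; the result
    is the [k]-th power of the characteristic function of one step. *)
Lemma mean_cos_sum (P Q : pred Omega) (p lam : R) (k : nat) :
  (forall o, ~~ (P o && Q o)) ->
  mean (fun o => (P o)%:R) = p -> mean (fun o => (Q o)%:R) = p ->
  mean (fun W : {ffun 'I_k -> Omega} =>
    cos (lam * \sum_l ((P (W l))%:R - (Q (W l))%:R))) =
  (1 - 2 * p * (1 - cos lam)) ^+ k.
Proof.
move=> PQ Pp Qp; pose g (l : 'I_k) o : R := (P o)%:R - (Q o)%:R.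
pose F x := cos (lam * x).
transitivity (iter_mean g (enum 'I_k) F 0).
  rewrite -mean_sum_coord ?enum_uniq //; apply: eq_mean => W.
  by rewrite add0r big_enum.
have -> : (1 - 2 * p * (1 - cos lam)) ^+ k =
    F 0 * (1 - 2 * p * (1 - cos lam)) ^+ size (enum 'I_k).
  by rewrite /F mulr0 cos0 mul1r size_enum_ord.
elim: (enum _) 0 => [|l s IH] x /=; first by rewrite mulr1.
rewrite (eq_mean (fun o => IH _)).
pose c := (1 - 2 * p * (1 - cos lam)) ^+ size s; rewrite -/c.
rewrite (eq_mean (Y := fun o => c * F x + (c * (F (x + 1) - F x) * (P o)%:R +
   c * (F (x - 1) - F x) * (Q o)%:R))) => [|o].
  rewrite !meanD mean_cst // !meanZ Pp Qp exprS -/c.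
  have -> : F (x + 1) = F x * cos lam - sin (lam * x) * sin lam.
    by rewrite /F mulrDr mulr1 cosD.
  have -> : F (x - 1) = F x * cos lam + sin (lam * x) * sin lam.
    by rewrite /F mulrBr mulr1 cosB.
  by ring.
have := PQ o; rewrite /g; case: (P o); case: (Q o) => //= _;
  rewrite ?(subr0, sub0r, mulr0, mulr1, addr0, add0r); ring.
Qed.

End FourierBounds.

(** Doubling [x] until it reaches [[1/2, 1]]: [1 - cos (2 x) <= 4 * (1 - cos x)], while [x^2] grows
    by exactly [4]. The index [a] bounds the number of doublings. *)
Lemma cos_quadratic (R : realType) (a : nat) (x : R) : (2 ^ a.+1)%:R^-1 <= x <= 1 ->
  (1 - cos 2^-1) * x ^+ 2 <= 1 - cos x.
Proof.
have c1 := cos_half_lt1 R.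
have base (y : R) : 2^-1 <= y <= 1 -> (1 - cos 2^-1) * y ^+ 2 <= 1 - cos y.
  move=> yP; have := cos_le_half yP; have /andP[y0 y1] := yP.
  have : y ^+ 2 <= 1 by nra.
  by nra.
elim: a x => [|a IH] x; first by rewrite expn1; exact: base.
move=> /andP[x0 x1]; have [h|h] := lerP 2^-1 x; first by apply: base; rewrite h.
have : (1 - cos 2^-1) * (x *+ 2) ^+ 2 <= 1 - cos (x *+ 2).
  apply: IH; rewrite -[x *+ 2]mulr_natr; apply/andP; split; last by lra.
  move: x0; rewrite expnS natrM invfM mulrC ler_pdivrMr //.
by rewrite cos_mulr2n -[x *+ 2]mulr_natr; have := cos_le1 x; have := cos_geN1 x; nra.
Qed.

(** * Anti-concentration of the median *)

Section Lower.
Variables (R : realType) (k n B m : nat) (i : 'I_n).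
Hypotheses (B3 : (3 <= B)%N) (km : k = m.*2.+1) (k2 : (2 <= k)%N) (kn : (k * B <= n)%N).

Let B0 : (0 < B)%N. Proof. exact: leq_trans B3. Qed.
Let B0' : 0 < B%:R :> R. Proof. by rewrite ltr0n. Qed.

Local Notation err := (@row_error R n B i).
Local Notation rho := ((2 - cos 2^-1)^-1 : R).

Lemma rho_lt1 : 0 < rho < 1.
Proof.
have c1 := cos_half_lt1 R; rewrite invr_gt0 invf_lt1; last by lra.
by apply/andP; split; lra.
Qed.

(** [2 * a <= k] and [k * B <= n] give [2 * (B * a) <= n], so the ranks required by [row_fourier]
    are present. *)
Lemma mean_cos_err (a : nat) : (0 < a)%N -> (2 * a <= k)%N ->
  mean (fun r => cos (a%:R * (B%:R * err r))) <= rho ^+ a.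
Proof.
move=> a0 ak; rewrite exprVn.
have := @row_fourier R n B i B3 a a0; rewrite -(mean_row_error i B0) => le_a.
apply: le_trans (le_a _); last by nia.
by apply: le_mean => r; rewrite natrM mulrA [a%:R * _]mulrC.
Qed.

Lemma mean_err_small (N : nat) : (0 < N)%N -> (2 * N.-1 <= k)%N ->
  mean (fun r => (`|err r| <= (B%:R * N%:R)^-1)%R%:R) <=
  2 / ((1 - rho) * cos 1 ^+ 2) / N%:R.
Proof.
move=> N0 Nk; have /andP[r0 r1] := rho_lt1; have N0' : 0 < N%:R :> R by rewrite ltr0n.
apply: le_trans (_ : mean (fun r => (`|B%:R * err r| <= N%:R^-1)%R%:R) <= _).
  apply: le_mean => r; rewrite normrM normr_nat invfM mulrC.
  by rewrite ler_pdivlMr // mulrC.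
apply: mean_small_le => //; first exact: card_sketch_row_gt0.
  by rewrite (ltW r0).
by move=> a /andP[a0 aN]; apply: mean_cos_err => //; lia.
Qed.

(** The bound [rho] on the mean of [cos (B * err)] and the gap give [(1 - rho) / 4] for the absolute
    error; symmetry halves it. *)
Lemma mean_err_gt_ge (d : R) : 0 < d ->
  (forall y, ((1 + rho) / 2 - cos y) / 2 <= (d < `|y|)%R%:R) ->
  (1 - rho) / 8 <= mean (fun r => (d / B%:R < err r)%R%:R).
Proof.
move=> d0 gap.
have dB : 0 <= d / B%:R by rewrite divr_ge0 ?ltW.
have := mean_cos_err (ltn0Sn 0) k2; rewrite expr1 => four.
suff : (1 - rho) / 4 <= mean (fun r => (d / B%:R < `|err r|)%R%:R).
  by rewrite mean_err_norm //; lra.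
apply: (@le_trans _ _ (mean (fun r => 2^-1 * ((1 + rho) / 2 - cos (1 * (B%:R * err r)))))).
  by rewrite meanZ meanB mean_cst ?card_sketch_row_gt0 //; lra.
apply: le_mean => r; rewrite mulrC mul1r; apply: le_trans (gap _) _.
by rewrite normrM normr_nat ltr_pdivrMr // mulrC.
Qed.

Lemma markov_median_error (t : R) : 0 <= t ->
  t * mean (fun W : {ffun 'I_k -> sketch_row n B} => (t < `|median_error R i W|)%R%:R) <=
  expected_error R k B i.
Proof.
move=> t0; rewrite expected_errorE -meanZ; apply: le_mean => W.
by case: (ltrP t) => [/ltW|_]; rewrite ?mulr1 ?mulr0.
Qed.

(** If all rows err upwards by more than [d / B], so does the median. The loss is exponential in
    [k], which is harmless for bounded [k]. *)
Lemma expected_error_ge_expr (d : R) : 0 < d ->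
  (forall y, ((1 + rho) / 2 - cos y) / 2 <= (d < `|y|)%R%:R) ->
  d / B%:R * ((1 - rho) / 8) ^+ k <= expected_error R k B i.
Proof.
move=> d0 gap; have dB : 0 <= d / B%:R by rewrite divr_ge0 ?ltW.
have /andP[r0 r1] := rho_lt1.
apply: le_trans (markov_median_error dB); rewrite ler_wpM2l //.
apply: (@le_trans _ _ (mean (fun W : {ffun 'I_k -> sketch_row n B} =>
   \prod_l (d / B%:R < err (W l))%R%:R))).
  rewrite (mean_prod_coord (fun _ r => (d / B%:R < err r)%R%:R)) prodr_const card_ord.
  rewrite lerXn2r ?nnegrE ?mean_err_gt_ge //; first by lra.
  by apply: mean_ge0 => r; rewrite ler0n.
apply: le_mean => W; rewrite norm_gt_split //.
case: (boolP [forall l, d / B%:R < err (W l)]) => [/forallP dW | /forallPn[l dl]].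
  rewrite (median_error_gt _ _ _ km) (_ : (m < _)%N) ?lerDl ?ler0n //.
    by rewrite big1 ?lerDl ?ler0n // => l _; rewrite dW.
  rewrite /row_count (eq_bigr (fun=> 1%N)) => [|l _]; last by rewrite dW.
  by rewrite sum_nat_const card_ord muln1; lia.
by rewrite (bigD1 l) //= (negPf dl) mul0r addr_ge0 ?ler0n.
Qed.

(* With a, b, M the numbers of rows whose error is above t, below -t, between,
   the median exceeds t in absolute value as soon as |a - b| > M. *)
Lemma median_error_gt_of_imbalance (W : {ffun 'I_k -> sketch_row n B}) (t y : R) :
  0 <= t -> 0 < y ->
  (y < `|\sum_l ((t < err (W l))%R%:R - (err (W l) < - t)%R%:R)|)%R%:R -
    y^-1 * \sum_l (`|err (W l)| <= t)%R%:R <=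
  (t < `|median_error R i W|)%R%:R :> R.
Proof.
move=> t0 y0.
pose a := row_count i (fun x => t < x) W; pose b := row_count i (fun x => x < - t) W.
set M := \sum_l (`|_| <= t)%R%:R.
have aE : \sum_l (t < err (W l))%R%:R = a%:R :> R by rewrite /a natr_sum.
have bE : \sum_l (err (W l) < - t)%R%:R = b%:R :> R by rewrite /b natr_sum.
have M0 : 0 <= M by apply: sumr_ge0 => l _; rewrite ler0n.
have kE : k%:R = 2 * m%:R + 1 :> R by rewrite km -natr1 -muln2 natrM mulrC.
have abM : a%:R + b%:R + M = 2 * m%:R + 1.
  rewrite -kE -aE -bE -!big_split /= -[k in RHS]card_ord -[RHS]sumr_const.
  apply: eq_bigr => l _; rewrite -norm_gt_split // ltNge.
  by case: (_ <= _); rewrite ?addr0 ?add0r.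
rewrite sumrB aE bE norm_gt_split // (median_error_gt _ _ _ km) (median_error_lt _ _ _ km).
rewrite -/a -/b.
have yM : 0 <= y^-1 * M by rewrite mulr_ge0 // invr_ge0 ltW.
have [yS|_] := ltrP y; last by rewrite mulr0n sub0r (le_trans _ (addr_ge0 _ _)) ?oppr_le0 ?ler0n.
have [yMle|My] := lerP y M.
  have : 1 <= y^-1 * M by rewrite mulrC ler_pdivlMr // mul1r.
  have := ler0n R (m < a); have := ler0n R (m < b); rewrite mulr1n; lra.
(* If [a - b > M], then [2 * a > a + b + M = 2 * m + 1], hence [m < a]; the other sign is
   symmetric. *)
have : (m < a)%N || (m < b)%N.
  rewrite -(ltr_nat R) -[X in _ || X](ltr_nat R).
  have := lt_trans My yS; rewrite ltr_normr => /orP[] h; apply/orP; [left | right]; lra.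
have := ler0n R (m < a); have := ler0n R (m < b).
by case: (m < a)%N; case: (m < b)%N => //= *; rewrite ?mulr1n ?mulr0n; lra.
Qed.

(** A row error is small with probability [pi0 <= C2 / N], where [N] is about [A * sqrt k]. The
    conditions on [A] give [pi0 <= 1/2] and bound the expected number of small rows by
    [(1 - rho1) / 8] times [d1 * sqrt k]; [2 * A <= sqrt k] gives [2 * (N - 1) <= k], as
    [mean_err_small] requires. *)
Lemma expected_error_ge_sqrt (d1 A : R) :
  let delta := 1 - cos 2^-1 in let rho1 := (1 + delta / 2)^-1 in
  let C2 := 2 / ((1 - rho) * cos 1 ^+ 2) in
  0 < d1 -> (forall y, ((1 + rho1) / 2 - cos y) / 2 <= (d1 < `|y|)%R%:R) ->
  1 <= A -> 2 * C2 <= A -> 8 * C2 / (d1 * (1 - rho1)) <= A ->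
  2 * A <= Num.sqrt k%:R ->
  (1 - rho1) / (16 * A) / (B%:R * Num.sqrt k%:R) <= expected_error R k B i.
Proof.
move=> delta rho1 C2 d10 gap A1 A2 A3 Ak.
have c1 := cos_half_lt1 R; have /andP[r0 r1] := rho_lt1.
have delta0 : 0 < delta by rewrite /delta subr_gt0.
have rho1_0 : 0 < rho1 by rewrite invr_gt0; lra.
have rho1_1 : rho1 < 1 by rewrite invf_lt1; lra.
have C20 : 0 < C2 by rewrite divr_gt0 // mulr_gt0 ?exprn_gt0 ?cos1_gt0 // subr_gt0.
have k0 : 0 < k%:R :> R by rewrite ltr0n km.
set s := Num.sqrt k%:R in Ak *.
have s0 : 0 < s by rewrite sqrtr_gt0.
have ss : s ^+ 2 = k%:R by rewrite sqr_sqrtr // ltW.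
have As : 0 <= A * s by rewrite mulr_ge0 //; lra.
pose N := (Num.truncn (A * s)).+1.
have N_gt : A * s < N%:R by rewrite truncnS_gt.
have N0 : 0 < N%:R :> R by rewrite ltr0n.
have NA : N.-1%:R <= A * s by rewrite truncn_le.
have N_le : N%:R <= 2 * (A * s).
  have -> : N%:R = N.-1%:R + 1 :> R by rewrite natr1.
  have : 1 <= A * s by nra.
  by lra.
have Nk : (2 * N.-1 <= k)%N by rewrite -(ler_nat R) natrM -ss; nra.
pose t : R := (B%:R * N%:R)^-1.
have t0 : 0 < t by rewrite invr_gt0 mulr_gt0.
have := mean_err_small (ltn0Sn _) Nk; rewrite -/N -/C2 -/t.
set pi0 := mean _ => pi0_le.
have pi0_half : pi0 <= 2^-1.
  apply: le_trans pi0_le _; rewrite ler_pdivrMr //; nra.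
have pi00 : 0 <= pi0 by apply: mean_ge0 => r; rewrite ler0n.
pose p : R := mean (fun r => (t < err r)%R%:R).
have pE : 2 * p = 1 - pi0.
  by rewrite /pi0 mean_err_norm_le // mean_err_norm ?(ltW t0) // -/p; lra.
pose lam := s^-1.
have lam1 : lam <= 1 by rewrite invf_le1 //; lra.
have lam0 : 0 < lam by rewrite invr_gt0.
(* Since [sqrt k <= k < 2 ^ (k + 1)], [k] is a sufficient dyadic depth. *)
have quad : delta / k%:R <= 1 - cos lam.
  rewrite -ss -exprVn; apply: (@cos_quadratic _ k); rewrite -/lam lam1 andbT.
  rewrite lef_pV2 ?posrE ?ltr0n ?expn_gt0 //.
  have le_sk : s <= k%:R by rewrite -ss; nra.
  by apply: le_trans le_sk _; rewrite ler_nat ltnW // ltnW // ltn_expl.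
have cos_lam : 0 <= cos lam.
  by apply: cos_ge0_pihalf; have := pihalf_ge1 R; move=> ?; apply/andP; split; lra.
pose S (W : {ffun 'I_k -> sketch_row n B}) : R :=
  \sum_l ((t < err (W l))%R%:R - (err (W l) < - t)%R%:R).
(* As [2 * p = 1 - pi0 >= 1/2], the [k] steps accumulate at least [delta / 2], which produces
   [rho1]. *)
have mean_cosS : mean (fun W => cos (lam * S W)) <= rho1.
  rewrite (@mean_cos_sum _ _ (card_sketch_row_gt0 n B0) (fun r => t < err r)
    (fun r => err r < - t) p) ?mean_err_lt //; last first.
    by move=> r; apply/negP => /andP[? ?]; lra.
  have x01 : 0 <= 2 * p * (1 - cos lam) <= 1.
    by have := cos_le1 lam; rewrite pE => ?; apply/andP; split; nra.
  apply: le_trans (expr_1B_le k x01) _.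
  have : delta <= k%:R * (1 - cos lam) by rewrite mulrC -ler_pdivrMr.
  rewrite pE => le_d; have : delta / 2 <= k%:R * ((1 - pi0) * (1 - cos lam)) by nra.
  by move=> ?; rewrite lef_pV2 ?posrE; lra.
pose M (W : {ffun 'I_k -> sketch_row n B}) : R := \sum_l (`|err (W l)| <= t)%R%:R.
have meanM : mean M = k%:R * pi0.
  rewrite /M mean_sum (eq_bigr (fun=> pi0)) ?sumr_const ?card_ord ?mulr_natl //.
  by move=> l _; rewrite (mean_coord l (fun r => (`|err r| <= t)%R%:R)) ?card_sketch_row_gt0.
have y0 : 0 < d1 * s by rewrite mulr_gt0.
have main : (1 - rho1) / 8 <=
    mean (fun W : {ffun 'I_k -> sketch_row n B} => (t < `|median_error R i W|)%R%:R).
  apply: (@le_trans _ _ (mean (fun W =>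
      2^-1 * ((1 + rho1) / 2 - cos (lam * S W)) - (d1 * s)^-1 * M W))); last first.
    apply: le_mean => W.
    apply: le_trans (median_error_gt_of_imbalance W (ltW t0) y0); rewrite lerD2r mulrC.
    apply: le_trans (gap _) _; rewrite normrM gtr0_norm // mulrC ltr_pdivlMr //.
  rewrite meanB !meanZ meanB meanM mean_cst; last by rewrite card_ffun expn_gt0 card_sketch_row_gt0.
  (* The imbalance contributes [(1 - rho1) / 4]; the small rows may consume half of it. *)
  suff : (d1 * s)^-1 * (k%:R * pi0) <= (1 - rho1) / 8 by lra.
  rewrite mulrC ler_pdivrMr // -ss.
  have : s * pi0 <= d1 * (1 - rho1) / 8; last by nra.
  have : pi0 * N%:R <= C2 by rewrite -ler_pdivlMr.
  move: A3; rewrite ler_pdivrMr ?mulr_gt0 ?subr_gt0 // => A3 pN.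
  have : A * (s * pi0) <= A * (d1 * (1 - rho1) / 8) by nra.
  by rewrite ler_pM2l //; lra.
apply: le_trans (markov_median_error (ltW t0)).
apply: le_trans (ler_wpM2l (ltW t0) main).
have A0 : 0 < A by lra.
have -> : (1 - rho1) / (16 * A) / (B%:R * s) = (1 - rho1) / 8 / (B%:R * (2 * (A * s))).
  by field; rewrite !gt_eqF.
rewrite mulrC ler_wpM2r ?divr_ge0 ?subr_ge0 ?(ltW rho1_1) //.
by rewrite lef_pV2 ?posrE ?mulr_gt0 // ler_pM2l.
Qed.

End Lower.

Theorem theorem4p4 (R : realType) :
  exists c C : R, 0 < c /\ 0 < C /\
    forall (k n B : nat), (3 <= k)%N -> odd k -> (k * B <= n)%N -> (k <= B)%N ->
    forall i : 'I_n,
      c / (B%:R * Num.sqrt k%:R * ln k%:R) <= expected_error R k B i /\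
      expected_error R k B i <= C / (B%:R * Num.sqrt k%:R).
Proof.
Proof.
pose delta : R := 1 - cos 2^-1; pose rho : R := (2 - cos 2^-1)^-1.
pose rho1 := (1 + delta / 2)^-1; pose C2 := 2 / ((1 - rho) * cos 1 ^+ 2).
have c1 := cos_half_lt1 R.
have [r0 r1] : 0 < rho /\ rho < 1 by apply/andP; exact: rho_lt1.
have delta0 : 0 < delta by rewrite subr_gt0.
have rho1_0 : 0 < rho1 by rewrite invr_gt0; lra.
have rho1_1 : rho1 < 1 by rewrite invf_lt1; lra.
have C20 : 0 < C2 by rewrite divr_gt0 // mulr_gt0 ?exprn_gt0 ?cos1_gt0 // subr_gt0.
have [d d0 gap] : exists2 d : R, 0 < d &
    forall y, ((1 + rho) / 2 - cos y) / 2 <= (d < `|y|)%R%:R.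
  by apply: cos_gap; rewrite r1 andbT (le_trans _ (ltW r0)) // oppr_le0.
have [d1 d10 gap1] : exists2 d : R, 0 < d &
    forall y, ((1 + rho1) / 2 - cos y) / 2 <= (d < `|y|)%R%:R.
  by apply: cos_gap; rewrite rho1_1 andbT (le_trans _ (ltW rho1_0)) // oppr_le0.
pose A3 := 8 * C2 / (d1 * (1 - rho1)).
have A30 : 0 < A3.
  by apply: divr_gt0; apply: mulr_gt0 => //; rewrite ?subr_gt0 ?ltr0n.
pose A := 1 + 2 * C2 + A3; have A0 : 0 < A by rewrite /A; lra.
(* Separates the two regimes: [k > K] implies [2 * A <= sqrt k]. *)
pose K := (Num.truncn (4 * A ^+ 2)).+1.
pose cS := d * ((1 - rho) / 8) ^+ K; pose cL := (1 - rho1) / (16 * A).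
have rho8 : 0 < (1 - rho) / 8 by rewrite divr_gt0 // subr_gt0.
have rho81 : (1 - rho) / 8 <= 1 by lra.
have cS0 : 0 < cS by rewrite mulr_gt0 ?exprn_gt0.
have cL0 : 0 < cL by rewrite divr_gt0 ?mulr_gt0 // subr_gt0.
pose c := Num.min cS cL; have c0 : 0 < c by rewrite lt_min cS0.
have ln3 : 0 < ln 3 :> R by rewrite ln_gt0 // ltr1n.
(* Both regimes yield the lower bound [c / (B * sqrt k)], and [ln 3 <= ln k] turns it into one with
   the logarithm. *)
exists (c * ln 3), (1 + 384 * 180 ^+ 2); split; first by rewrite mulr_gt0.
split; first by rewrite addr_gt0 ?mulr_gt0 ?exprn_gt0 ?ltr0n.
move=> k n B k3 k_odd kn kB i.
have B3 : (3 <= B)%N by apply: leq_trans kB.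
have km : k = k./2.*2.+1 by rewrite -[LHS]odd_double_half k_odd.
have B0 : 0 < B%:R :> R by rewrite ltr0n (leq_trans _ B3).
have k0 : 0 < k%:R :> R by rewrite ltr0n (leq_trans _ k3).
have s1 : 1 <= Num.sqrt k%:R :> R 
  by rewrite -[leLHS]sqrtr1 ler_sqrt // ler1n (leq_trans _ k3).
have s0 : 0 < Num.sqrt k%:R :> R by lra.
split; last by apply: expected_error_le B3 km _; rewrite half_gt0 (leq_trans _ k3).
apply: (@le_trans _ _ (c / (B%:R * Num.sqrt k%:R))).
  have lnk : ln 3 <= ln k%:R :> R by rewrite ler_ln ?posrE // ler_nat.
  have lnk0 : 0 < ln k%:R :> R by lra.
  rewrite ler_pdivrMr ?mulr_gt0 // mulrA divfK ?gt_eqF ?mulr_gt0 //.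
  by rewrite ler_pM2l.
(* For [k <= K] the exponential loss is at worst its value at [K], and [sqrt k >= 1] allows the
   division by [sqrt k]. *)
have [kK|Kk] := leqP k K.
  apply: le_trans (expected_error_ge_expr i B3 km (ltnW k3) kn d0 gap).
  rewrite -/rho invfM mulrA mulrAC [leRHS]mulrAC ler_wpM2r ?invr_ge0 ?(ltW B0) //.
  apply: (@le_trans _ _ cS); last first.
    by rewrite ler_pM2l // ler_wiXn2l ?(ltW rho8).
  rewrite ler_pdivrMr //; apply: le_trans (_ : cS * 1 <= _); last by rewrite ler_pM2l.
  by rewrite mulr1 ge_min lexx.
apply: (@le_trans _ _ (cL / (B%:R * Num.sqrt k%:R))).
  by rewrite ler_wpM2r ?invr_ge0 ?mulr_ge0 ?(ltW B0) ?(ltW s0) // ge_min lexx orbT.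
have := @expected_error_ge_sqrt R k n B _ i B3 km (ltnW k3) kn d1 A d10 gap1.
apply; rewrite -/rho -/C2 -/rho1 -/A3 /A; try lra.
have -> : 2 * (1 + 2 * C2 + A3) = Num.sqrt ((2 * A) ^+ 2).
  by rewrite sqrtr_sqr gtr0_norm // mulr_gt0.
rewrite ler_sqrt // exprMn -natrX; apply: le_trans (ltW (truncnS_gt _)) _.
by rewrite ler_nat ltnW.
Qed.
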